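(* Let $k$ be a field and $G$ a finite group. Then the inclusion $H^*(G,k)\hookrightarrow HH^*(kG)$ induced by the cochain map $$(\varphi:\overline{G}^{\times n}\to k)\longmapsto(\psi:\overline{G}^{\times n}\to kG),\qquad \psi(g_1,\dots,g_n)=\varphi(g_1,\dots,g_n)\,g_1\cdots g_n,$$ makes $H^*(G,k)$ a Batalin–Vilkovisky subalgebra of $HH^*(kG)$: the image is closed under the cup product, the Lie bracket and the operator $\bigtriangleup$, with $\bigtriangleup$ restricting to the operator $\bigtriangleup_1$ and the cup product restricting to the cup product of $H^*(G,k)$.
   Context: Write $\overline{G}=G\setminus\{1\}$. For a $k$-vector space $V$, $\mathrm{Map}(\overline{G}^{\times n},V)$ denotes all maps of sets, identified with $\mathrm{Hom}_k((kG/k\cdot 1)^{\otimes n},V)$ (and with $V$ for $n=0$); accordingly, in every formula such a map takes the value $0$ whenever one of its arguments equals $1$, and for cochains with values in $kG$ inserted as arguments one extends multilinearly over $kG$. Hochschild cohomology: $HH^*(kG)$ is the cohomology of $C^n(kG)=\mathrm{Map}(\overline{G}^{\times n},kG)$ with differential $\delta_0(a)(g)=ga-ag$ and $$\delta_n(\varphi)(g_1,\dots,g_{n+1})=g_1\varphi(g_2,\dots,g_{n+1})+\sum_{i=1}^n(-1)^i\varphi(g_1,\dots,g_ig_{i+1},\dots,g_{n+1})+(-1)^{n+1}\varphi(g_1,\dots,g_n)g_{n+1}.$$ Group cohomology $H^*(G,k)$ (trivial coefficients) is the cohomology of $\mathrm{Map}(\overline{G}^{\times n},k)$ with $$\delta_n(\psi)(g_1,\dots,g_{n+1})=\psi(g_2,\dots,g_{n+1})+\sum_{i=1}^n(-1)^i\psi(g_1,\dots,g_ig_{i+1},\dots,g_{n+1})+(-1)^{n+1}\psi(g_1,\dots,g_n).$$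 Operations on $HH^*(kG)$, induced from cochains $f\in C^n(kG)$, $g\in C^m(kG)$: (1) cup product $(f\cup g)(g_1,\dots,g_{n+m})=f(g_1,\dots,g_n)g(g_{n+1},\dots,g_{n+m})$; (2) Lie bracket $[f,g]=f\circ g-(-1)^{(n-1)(m-1)}g\circ f\in C^{n+m-1}(kG)$, where $f\circ g=\sum_{i=1}^n(-1)^{(m-1)(i-1)}f\circ_ig$ and $f\circ_ig(a_1,\dots,a_{n+m-1})=f(a_1,\dots,a_{i-1},g(a_i,\dots,a_{i+m-1}),a_{i+m},\dots,a_{n+m-1})$ (for $m=0$ the element $g\in kG$ is inserted in the $i$-th position; $f\circ g=0$ if $n=0$); (3) for $n\ge1$, $\bigtriangleup(f)(g_1,\dots,g_{n-1})=\sum_{g_n\in G}\sum_{i=1}^n(-1)^{i(n-1)}\langle f(g_i,\dots,g_{n-1},g_n,g_1,\dots,g_{i-1}),1\rangle g_n^{-1}$, where $\langle\ ,\ \rangle$ is the bilinear form on $kG$ with $\langle g,h\rangle=1$ if $g=h^{-1}$ and $0$ otherwise; $\bigtriangleup=0$ in degree $0$. With these operations $HH^*(kG)$ is a Batalin–Vilkovisky algebra, with sign convention $[\alpha,\beta]=-(-1)^{(|\alpha|-1)|\beta|}(\bigtriangleup(\alpha\cup\beta)-\bigtriangleup(\alpha)\cup\beta-(-1)^{|\alpha|}\alpha\cup\bigtriangleup(\beta))$. Operations on $H^*(G,k)$: the cup product $(\varphi\cup\varphi')(g_1,\dots,g_{n+m})=\varphi(g_1,\dots,g_n)\varphi'(g_{n+1},\dots,g_{n+m})$,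 and the operator $\bigtriangleup_1:H^n(G,k)\to H^{n-1}(G,k)$ ($n\ge1$; zero in degree $0$) given by $$\bigtriangleup_1(\varphi)(g_1,\dots,g_{n-1})=\sum_{i=1}^n(-1)^{i(n-1)}\varphi(g_i,\dots,g_{n-1},\,g_{n-1}^{-1}\cdots g_1^{-1},\,g_1,\dots,g_{i-1}).$$ *)

(* Defs.v *)
From HB Require Import structures.
From mathcomp Require Import all_boot all_order all_fingroup all_algebra.

Set Implicit Arguments.
Unset Strict Implicit.
Unset Printing Implicit Defensive.

Import GRing.Theory.
Local Open Scope ring_scope.

Section GroupAlgebra.
Variables (k : fieldType) (gT : finGroupType).

(* An element a of kG is its coefficient function: a = \sum_g a g *: g.       *)
(* This alias carries the convolution product, not the pointwise one of ffun. *)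
Definition galg := {ffun gT -> k^o}.
HB.instance Definition _ := Vector.on galg.

Definition galg_elt (g : gT) : galg := [ffun h => (h == g)%:R].

Definition galg_mul (a b : galg) : galg :=
  [ffun g => \sum_h a h * b (h^-1 * g)%g].

Fact galg_mulA : associative galg_mul.
Proof.
move=> a b c; apply/ffunP=> g; rewrite !ffunE.
under eq_bigr => h _ do rewrite ffunE big_distrr /=.
under [RHS]eq_bigr => h _ do rewrite ffunE big_distrl /=.
rewrite [RHS]exchange_big /=; apply: eq_bigr => h _.
rewrite (reindex_inj (mulgI h^-1)%g) /=; apply: eq_bigr => l _.
by rewrite mulrA invMg invgK mulgA mulgK.
Qed.

Fact galg_mul1l : left_id (galg_elt 1) galg_mul.
Proof.
move=> a; apply/ffunP=> g; rewrite ffunE (bigD1 1%g) //= ffunE eqxx mul1r.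
rewrite invg1 mul1g big1 ?addr0 // => h /negPf h1.
by rewrite ffunE h1 mul0r.
Qed.

Fact galg_mul1r : right_id (galg_elt 1) galg_mul.
Proof.
move=> a; apply/ffunP=> g; rewrite ffunE (bigD1 g) //= ffunE mulVg eqxx mulr1.
rewrite big1 ?addr0 // => h hg; rewrite ffunE -eq_mulVg1.
by rewrite (negPf hg) mulr0.
Qed.

Fact galg_mulDl : left_distributive galg_mul +%R.
Proof.
move=> a b c; apply/ffunP=> g; rewrite !ffunE -big_split /=.
by apply: eq_bigr => h _; rewrite ffunE mulrDl.
Qed.

Fact galg_mulDr : right_distributive galg_mul +%R.
Proof.
move=> a b c; apply/ffunP=> g; rewrite !ffunE -big_split /=.
by apply: eq_bigr => h _; rewrite ffunE mulrDr.
Qed.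

Fact galg_1neq0 : galg_elt 1 != 0.
Proof.
by apply/eqP=> /ffunP/(_ 1%g)/eqP; rewrite !ffunE eqxx oner_eq0.
Qed.

HB.instance Definition _ := GRing.Zmodule_isNzRing.Build galg
  galg_mulA galg_mul1l galg_mul1r galg_mulDl galg_mulDr galg_1neq0.

Fact galg_scaleAl (c : k) (a b : galg) : c *: (a * b) = c *: a * b.
Proof.
apply/ffunP=> g; rewrite !ffunE /GRing.scale /= big_distrr /=.
by apply: eq_bigr => h _; rewrite ffunE mulrA.
Qed.

HB.instance Definition _ := GRing.Lmodule_isLalgebra.Build k galg galg_scaleAl.

Fact galg_scaleAr (c : k) (a b : galg) : c *: (a * b) = a * (c *: b).
Proof.
apply/ffunP=> g; rewrite !ffunE /GRing.scale /= big_distrr /=.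
by apply: eq_bigr => h _; rewrite ffunE mulrCA.
Qed.

HB.instance Definition _ := GRing.Lalgebra_isAlgebra.Build k galg galg_scaleAr.

(* The bilinear form with value 1 on (g, g^-1) and 0 on (g, h), h != g^-1. *)
Definition galg_form (a b : galg) : k := \sum_g a g * b g^-1%g.

End GroupAlgebra.

Section Cochains.
Variables (k : fieldType) (gT : finGroupType) (V : vectType k).

Definition gbar := {g : gT | g != 1%g}.

Definition cochain n := {ffun n.-tuple gbar -> V}.
HB.instance Definition _ n := Vector.on (cochain n).

(* The value of an n-cochain on a list of n elements of G: pmap insub drops   *)
(* the entries equal to 1, so the value is 0 as soon as there is one.  (It is *)
(* a junk value on lists of length other than n, which never occur below.)    *)
Definition cev n (f : cochain n) (s : seq gT) : V :=
  if insub (pmap insub s : seq gbar) is Some t then f t else 0.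

(* The n-cochain (g_1, ..., g_n) |-> F [:: g_1; ...; g_n]. *)
Definition mkcochain n (F : seq gT -> V) : cochain n :=
  [ffun t : n.-tuple gbar => F (map val t)].

Fact cev_linear n (s : seq gT) : linear (fun f : cochain n => cev f s).
Proof.
by move=> c f g; rewrite /cev; case: insub => [t|]; rewrite ?ffunE ?scaler0 ?addr0.
Qed.

(* (g_1, ..., g_r) with g_i and g_(i+1) replaced by g_i g_(i+1), for i >= 1. *)
Definition merge_at (i : nat) (s : seq gT) : seq gT :=
  take i.-1 s ++ (nth 1 s i.-1 * nth 1 s i)%g :: drop i.+1 s.

End Cochains.

Section Subquotient.
Variables (k : fieldType) (V : vectType k) (Z B : {vspace V}).

Definition in_sub : pred (subvs_of Z) := fun z => vsval z \in B.

Fact in_sub_zmod : zmod_closed in_sub.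
Proof.
split=> [|x y]; first by rewrite -[_ \in _]/(vsval 0 \in B) raddf0 mem0v.
by move=> xB yB; rewrite -[_ \in _]/(vsval (x - y) \in B) raddfB rpredB.
Qed.
HB.instance Definition _ :=
  GRing.isZmodClosed.Build (subvs_of Z) in_sub in_sub_zmod.

(* The vector space Z / (Z :&: B). *)
Definition subquot := Quotient.quot (GRing.ZmodClosed.clone _ in_sub _).
HB.instance Definition _ := GRing.Zmodule.on subquot.
HB.instance Definition _ := EqQuotient.on subquot.

(* The class of v; to be used for v in Z only. *)
Definition sqclass (v : V) : subquot := \pi_subquot%qT (vsproj Z v).

(* A representative, in Z, of the class x. *)
Definition sqrep (x : subquot) : V := vsval (generic_quotient.repr x).

Lemma sqrep_mem x : sqrep x \in Z.
Proof. exact: subvsP. Qed.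

Lemma sqrepK : cancel sqrep sqclass.
Proof. by move=> x; rewrite /sqclass /sqrep vsvalK reprK. Qed.

Lemma sqclass_eq : {in Z &, forall u v, (sqclass u == sqclass v) = (u - v \in B)}.
Proof.
move=> u v uZ vZ; rewrite /sqclass -Quotient.idealrBE -[LHS]/(vsval _ \in B).
by rewrite raddfB /= !vsprojK.
Qed.

Lemma sqclassD : {morph sqclass : u v / u + v}.
Proof. by move=> u v; rewrite /sqclass !raddfD. Qed.

Definition sqscale (c : k) (x : subquot) : subquot := sqclass (c *: sqrep x).

Lemma sqclassZ c : {in Z, forall v, sqclass (c *: v) = sqscale c (sqclass v)}.
Proof.
move=> v vZ; apply/eqP; rewrite /sqscale sqclass_eq ?rpredZ ?sqrep_mem //.
rewrite -scalerBr rpredZ // -sqclass_eq ?sqrep_mem //.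
by rewrite sqrepK.
Qed.

Fact sqscaleA a b x : sqscale a (sqscale b x) = sqscale (a * b) x.
Proof.
by rewrite {2}/sqscale -sqclassZ ?rpredZ ?sqrep_mem // scalerA.
Qed.

Fact sqscale1 : left_id 1 sqscale.
Proof. by move=> x; rewrite /sqscale scale1r sqrepK. Qed.

Fact sqscaleDr : right_distributive sqscale +%R.
Proof.
move=> c x y; rewrite -{1}[x]sqrepK -{1}[y]sqrepK -sqclassD.
by rewrite -sqclassZ ?rpredD ?sqrep_mem // scalerDr sqclassD.
Qed.

Fact sqscaleDl x : {morph sqscale^~ x : a b / a + b}.
Proof. by move=> a b; rewrite /sqscale scalerDl sqclassD. Qed.

HB.instance Definition _ := GRing.Zmodule_isLmodule.Build k subquot
  sqscaleA sqscale1 sqscaleDr sqscaleDl.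

End Subquotient.

(* sqlift1 F and sqlift2 F apply F to chosen representatives.  They are the   *)
(* operations induced by F on classes exactly when induces1 F (sqlift1 F),    *)
(* resp. induces2 F (sqlift2 F), holds: then F preserves the numerators and   *)
(* the class of the result does not depend on the representatives.            *)
Section Induced.
Variables (k : fieldType) (V1 V2 V3 : vectType k).
Variables (Z1 B1 : {vspace V1}) (Z2 B2 : {vspace V2}) (Z3 B3 : {vspace V3}).

Definition sqlift1 (F : V1 -> V2) (x : subquot Z1 B1) : subquot Z2 B2 :=
  sqclass Z2 B2 (F (sqrep x)).

Definition sqlift2 (F : V1 -> V2 -> V3) (x : subquot Z1 B1) (y : subquot Z2 B2) :
    subquot Z3 B3 :=
  sqclass Z3 B3 (F (sqrep x) (sqrep y)).

Definition induces1 (F : V1 -> V2) (Fq : subquot Z1 B1 -> subquot Z2 B2) :=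
  forall u, u \in Z1 -> F u \in Z2 /\ Fq (sqclass Z1 B1 u) = sqclass Z2 B2 (F u).

Definition induces2 (F : V1 -> V2 -> V3)
    (Fq : subquot Z1 B1 -> subquot Z2 B2 -> subquot Z3 B3) :=
  forall u v, u \in Z1 -> v \in Z2 ->
    F u v \in Z3 /\
    Fq (sqclass Z1 B1 u) (sqclass Z2 B2 v) = sqclass Z3 B3 (F u v).

End Induced.
Arguments sqlift1 {k V1 V2 Z1 B1 Z2 B2} F x.
Arguments sqlift2 {k V1 V2 V3 Z1 B1 Z2 B2 Z3 B3} F x y.

Section CochainComplex.
Variables (k : fieldType) (C : nat -> vectType k).
Variable d : forall n, {linear C n -> C n.+1}.

Definition cocycles n : {vspace C n} := lker (linfun (d n)).

Definition coboundaries n : {vspace C n} :=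
  match n with
  | 0 => 0%VS
  | m.+1 => limg (linfun (d m))
  end.

Definition cohomology n := subquot (cocycles n) (coboundaries n).

End CochainComplex.

Section Differentials.
Variables (k : fieldType) (gT : finGroupType).

Local Notation kG := (galg k gT).
Local Notation C := (cochain gT kG).
Local Notation D := (cochain gT k^o).
Local Notation "<< g >>" := (galg_elt k g).

Definition hoch_diff n (f : C n) : C n.+1 := mkcochain n.+1 (fun s =>
  <<nth 1%g s 0>> * cev f (drop 1 s)
  + \sum_(1 <= i < n.+1) (-1) ^+ i *: cev f (merge_at i s)
  + (-1) ^+ n.+1 *: (cev f (take n s) * <<nth 1%g s n>>)).

Fact hoch_diff_linear n : linear (@hoch_diff n).
Proof.
move=> c f g; apply/ffunP=> t; rewrite !ffunE !cev_linear.
rewrite mulrDr mulrDl -scalerAr -scalerAl !scalerDr !scalerA.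
under eq_bigr => i _ do rewrite cev_linear scalerDr scalerA mulrC -scalerA.
rewrite big_split /= -scaler_sumr [_ ^+ n.+1 * c]mulrC.
by rewrite [RHS]addrACA; congr (_ + _); apply: addrACA.
Qed.
HB.instance Definition _ n := GRing.isSemilinear.Build k (C n) (C n.+1) _
  (@hoch_diff n) (GRing.semilinear_linear (@hoch_diff_linear n)).

Definition grp_diff n (f : D n) : D n.+1 := mkcochain n.+1 (fun s =>
  cev f (drop 1 s)
  + \sum_(1 <= i < n.+1) (-1) ^+ i * cev f (merge_at i s)
  + (-1) ^+ n.+1 * cev f (take n s)).

Fact grp_diff_linear n : linear (@grp_diff n).
Proof.
move=> c f g; apply/ffunP=> t; rewrite !ffunE !cev_linear.
under eq_bigr => i _ do rewrite cev_linear mulrDr -scalerAr.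
rewrite big_split /= -scaler_sumr mulrDr -scalerAr !scalerDr.
by rewrite [RHS]addrACA; congr (_ + _); apply: addrACA.
Qed.
HB.instance Definition _ n := GRing.isSemilinear.Build k (D n) (D n.+1) _
  (@grp_diff n) (GRing.semilinear_linear (@grp_diff_linear n)).

End Differentials.

Section Operations.
Variables (k : fieldType) (gT : finGroupType).

Local Notation kG := (galg k gT).
Local Notation C := (cochain gT kG).
Local Notation D := (cochain gT k^o).
Local Notation "<< g >>" := (galg_elt k g).

Definition hoch_unit : C 0 := mkcochain 0 (fun=> 1 : kG).
Definition grp_unit : D 0 := mkcochain 0 (fun=> 1 : k^o).

Definition hoch_cup n m (f : C n) (g : C m) : C (n + m)%N :=
  mkcochain (n + m) (fun s => cev f (take n s) * cev g (drop n s)).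

Definition grp_cup n m (f : D n) (g : D m) : D (n + m)%N :=
  mkcochain (n + m) (fun s => cev f (take n s) * cev g (drop n s)).

(* f o_i g, for 1 <= i <= n; the argument of f in position i is the element   *)
(* \sum_h (cev g _ h) *: h of kG, over which f is extended linearly.          *)
Definition hoch_comp_at n m (i : nat) (f : C n) (g : C m) (s : seq gT) : kG :=
  \sum_h cev g (take m (drop i.-1 s)) h *:
    cev f (take i.-1 s ++ h :: drop (i.-1 + m)%N s).

(* (-1)^((m-1)(i-1)) is written with m.+1 to avoid truncation at m = 0. *)
Definition hoch_comp n m (f : C n) (g : C m) (s : seq gT) : kG :=
  \sum_(1 <= i < n.+1) (-1) ^+ (m.+1 * i.-1) *: hoch_comp_at i f g s.

(* For n = m = 0 this is 0, so that the target C 0 is harmless. *)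
Definition hoch_bracket n m (f : C n) (g : C m) : C (n + m).-1 :=
  mkcochain (n + m).-1 (fun s =>
    hoch_comp f g s - (-1) ^+ (n.+1 * m.+1) *: hoch_comp g f s).

Definition hoch_bv n : C n -> C n.-1 :=
  match n with
  | 0 => fun=> 0
  | p.+1 => fun f => mkcochain p (fun s =>
      \sum_g \sum_(1 <= i < p.+2)
        ((-1) ^+ (i * p) * galg_form (cev f (rot i.-1 (rcons s g))) 1) *: <<g^-1%g>>)
  end.

Definition grp_bv n : D n -> D n.-1 :=
  match n with
  | 0 => fun=> 0
  | p.+1 => fun f => mkcochain p (fun s =>
      \sum_(1 <= i < p.+2) (-1) ^+ (i * p) *
        cev f (rot i.-1 (rcons s (\prod_(g <- rev s) g^-1)%g)))
  end.

Definition incl_cochain n (f : D n) : C n :=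
  mkcochain n (fun s => cev f s *: <<(\prod_(g <- s) g)%g>>).

End Operations.

Section CohomologyOperations.
Variables (k : fieldType) (gT : finGroupType).

Local Notation C := (fun n => cochain gT (galg k gT) n : vectType k).
Local Notation D := (fun n => cochain gT k^o n : vectType k).

Definition HH n :=
  cohomology (C := C) (fun i => @hoch_diff k gT i : {linear _ -> _}) n.
Definition HG n :=
  cohomology (C := D) (fun i => @grp_diff k gT i : {linear _ -> _}) n.

Definition HH_class n : cochain gT (galg k gT) n -> HH n := sqclass _ _.
Definition HG_class n : cochain gT k^o n -> HG n := sqclass _ _.

Definition HH_cup n m : HH n -> HH m -> HH (n + m)%N :=
  sqlift2 (@hoch_cup k gT n m).
Definition HH_bracket n m : HH n -> HH m -> HH (n + m).-1 :=
  sqlift2 (@hoch_bracket k gT n m).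
Definition HH_bv n : HH n -> HH n.-1 := sqlift1 (@hoch_bv k gT n).

Definition HG_cup n m : HG n -> HG m -> HG (n + m)%N :=
  sqlift2 (@grp_cup k gT n m).
Definition HG_bv n : HG n -> HG n.-1 := sqlift1 (@grp_bv k gT n).

Definition incl n : HG n -> HH n := sqlift1 (@incl_cochain k gT n).

Definition in_HG n (u : HH n) : Prop := exists x : HG n, u = incl x.

End CohomologyOperations.

(* Main.v *)
(* Every identity is proved for functions on lists of group elements, where it makes sense
   in all degrees at once.  Circle products are insertions of one cochain into the arguments
   of another; commuting them with the differential gives
     d (f o g) = f o dg +- df o g +- (g cup f) +- (f cup g),
   and the cup products cancel in the bracket.  The coefficient of the BV operator at g^-1 is
   the signed sum over the rotations of (g_1, ..., g_p, g) of the coefficient at 1, and this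
   cyclic sum intertwines the two bar differentials, so the BV operator anticommutes with d.
   The image of the inclusion consists of the cochains whose value at s is a multiple of the
   product of s; taking the coefficient at that product is a cochain map retracting the
   inclusion.  Injectivity, the closure of the image, and all the properties of the operations
   on H^*(G,k) follow from this retraction. *)

From HB Require Import structures.
Require Import Defs.
From mathcomp Require Import all_boot all_order all_fingroup all_algebra.
From mathcomp Require Import zify ring.

Set Implicit Arguments.
Unset Strict Implicit.
Unset Printing Implicit Defensive.

Import GRing.Theory.
Local Open Scope ring_scope.

Lemma eq_sign (R : pzRingType) a b : odd a = odd b -> (-1) ^+ a = (-1) ^+ b :> R.
Proof. by move=> ab; rewrite -signr_odd ab signr_odd. Qed.

(** * The bar differential on functions of lists *)

Section Bar.
Variables (k : fieldType) (gT : finGroupType).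
Implicit Types (m n : nat) (V : lmodType k) (s x y : seq gT).

(** The inner terms of the bar differential, shared by the two complexes. The degree is read off the
    length of the list, so coefficients can be in any module. *)
Definition bar V (F : seq gT -> V) s : V :=
  \sum_(1 <= i < size s) (-1) ^+ i *: F (merge_at i s).

Lemma size_merge_at i s : (0 < i < size s)%N -> (size (merge_at i s)).+1 = size s.
Proof. by rewrite /merge_at size_cat /= size_take size_drop; case: ifP; lia. Qed.

Lemma eq_bar V (F1 F2 : seq gT -> V) s :
  (forall u, (size u).+1 = size s -> F1 u = F2 u) -> bar F1 s = bar F2 s.
Proof.
move=> eqF; apply: eq_big_nat => i lti; congr (_ *: _); apply: eqF.
exact: size_merge_at.
Qed.

Lemma bar_sum V (I : finType) (c : I -> k) (F : I -> seq gT -> V) s :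
  bar (fun u => \sum_i c i *: F i u) s = \sum_i c i *: bar (F i) s.
Proof.
rewrite /bar; under eq_bigr do rewrite scaler_sumr.
rewrite exchange_big /=; apply: eq_bigr => i _; rewrite scaler_sumr.
by apply: eq_bigr => j _; rewrite !scalerA mulrC.
Qed.

Lemma barZ V (c : k) (F : seq gT -> V) s : bar (fun u => c *: F u) s = c *: bar F s.
Proof.
by rewrite /bar scaler_sumr; apply: eq_bigr => i _; rewrite !scalerA mulrC.
Qed.

Lemma bar_add V (F1 F2 : seq gT -> V) s :
  bar (fun u => F1 u + F2 u) s = bar F1 s + bar F2 s.
Proof.
by rewrite /bar -big_split; apply: eq_bigr => i _; rewrite scalerDr.
Qed.

Lemma bar0 V s : bar (fun=> 0 : V) s = 0.
Proof. by rewrite /bar big1 // => i _; rewrite scaler0. Qed.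

Lemma bar_nil V (F : seq gT -> V) : bar F [::] = 0.
Proof. by rewrite /bar big_geq. Qed.

Lemma bar_1 V (F : seq gT -> V) a : bar F [:: a] = 0.
Proof. by rewrite /bar big_geq. Qed.

Lemma bar_cons2 V (F : seq gT -> V) a b s :
  bar F [:: a, b & s] =
  - F ((a * b)%g :: s) - bar (fun u => F (a :: u)) (b :: s).
Proof.
rewrite /bar /= big_ltn // expr1 scaleN1r /merge_at /= drop0; congr (_ + _).
rewrite big_add1 /= -sumrN; apply: eq_big_nat => -[|j] // _.
by rewrite exprS mulN1r scaleNr.
Qed.

(** The term that merges a new first letter [a] into the head, with its sign -1; the value 0 on the
    empty list makes [bar_cons] uniform. *)
Definition bar_head V (F : seq gT -> V) a s : V :=
  if s is b :: s' then - F ((a * b)%g :: s') else 0.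

Lemma bar_cons V (F : seq gT -> V) a s :
  bar F (a :: s) = bar_head F a s - bar (fun u => F (a :: u)) s.
Proof.
by case: s => [|b s]; rewrite ?bar_cons2 //= bar_1 bar_nil subr0.
Qed.

Lemma bar_cat V (F : seq gT -> V) x y a b :
  bar F (rcons x a ++ b :: y) =
  bar (fun u => F (u ++ b :: y)) (rcons x a)
  + (-1) ^+ (size x).+1 *: (F (x ++ (a * b)%g :: y)
                            + bar (fun u => F (rcons x a ++ u)) (b :: y)).
Proof.
elim: x F => [|c x IH] F /=; first by rewrite bar_1 bar_cons2 expr1 scaleN1r add0r opprD.
rewrite bar_cons IH [in RHS]bar_cons [in RHS]exprS mulN1r scaleNr opprD addrA.
by congr (_ - _ - _); case: x {IH}.
Qed.

Lemma bar_rcons V (F : seq gT -> V) x a b :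
  bar F (rcons (rcons x a) b) =
  bar (fun u => F (rcons u b)) (rcons x a)
  + (-1) ^+ (size x).+1 *: F (rcons x (a * b)%g).
Proof.
rewrite -cats1 bar_cat bar_1 addr0 cats1; congr (_ + _).
by apply: eq_bar => u _; rewrite cats1.
Qed.

(** After a merge at [i <= m] the first [m] letters come from the first [m.+1] letters of [s]; a
    later merge leaves them intact and happens in [drop m s]. No merge is lost or counted twice. *)
Lemma bar_split V (Q : seq gT -> seq gT -> V) m s :
  bar (fun u => Q (take m u) (drop m u)) s =
  bar (fun u => Q u (drop m.+1 s)) (take m.+1 s)
  + (-1) ^+ m *: bar (fun u => Q (take m s) u) (drop m s).
Proof.
elim: m s Q => [|m IH] s Q.
  rewrite scale1r drop0 take0.
  under eq_bar do rewrite take0 drop0.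
  by case: s => [|a s]; rewrite /= ?take0 ?bar_nil ?bar_1 add0r.
case: s => [|a s] /=; first by rewrite !bar_nil scaler0 addr0.
rewrite !bar_cons /= (IH s (fun u v => Q (a :: u) v)) exprS mulN1r scaleNr.
by rewrite opprD addrA; congr (_ - _ - _); case: s.
Qed.

Definition normalized V (F : seq gT -> V) := forall s, 1%g \in s -> F s = 0.
Definition arity V (n : nat) (F : seq gT -> V) := forall s, size s != n -> F s = 0.

Lemma bar_arity V n (F : seq gT -> V) : arity n F -> arity n.+1 (bar F).
Proof.
move=> aF s sn; rewrite (@eq_bar _ _ (fun=> 0)) ?bar0 // => u us.
by rewrite aF // -eqSS us.
Qed.

(** Only the merges that absorb the letter 1 survive. Its left and right merges give the same list
    with opposite signs, so they cancel unless the letter is at an end. *)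
Lemma bar_one V (F : seq gT -> V) x y : normalized F ->
  bar F (x ++ 1%g :: y) =
  ((-1) ^+ (size x) * ((x != [::])%:R - (y != [::])%:R)) *: F (x ++ y).
Proof.
elim: x F => [|a x IH] F nF.
  rewrite bar_cons /= (@eq_bar _ _ (fun=> 0)) ?bar0; last first.
    by move=> u _; rewrite nF ?mem_head.
  case: y => [|b y] /=; first by rewrite !subrr mulr0 scale0r.
  by rewrite mul1g !subr0 add0r mulrN1 expr0 scaleN1r.
have nFa : normalized (fun u => F (a :: u)) by move=> u u1; rewrite nF // inE u1 orbT.
rewrite /= bar_cons IH //; case: x {IH} => [|b x] /=.
  rewrite mulg1 -scaleN1r -[X in _ - X]scale1r.
  by rewrite scale1r -scaleNr -scalerDl; congr (_ *: _); rewrite expr0 expr1; ring.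
rewrite nF ?oppr0 ?add0r; last by rewrite inE mem_cat mem_head !orbT.
by rewrite -scaleNr; congr (_ *: _); rewrite !exprS; ring.
Qed.

End Bar.

(** * Hochschild differential and cup product *)

Section GroupAlgebraTheory.
Variables (k : fieldType) (gT : finGroupType).
Local Notation kG := (galg k gT).
Local Notation "<< g >>" := (galg_elt k g).
Implicit Types (m n : nat) (a b g : gT) (x y : kG).

Lemma galg_eltE g h : <<g>> h = (h == g)%:R :> k.
Proof. by rewrite ffunE. Qed.

Lemma mul_galg_eltl a x g : (<<a>> * x) g = x (a^-1 * g)%g.
Proof.
rewrite [LHS]ffunE (bigD1 a) //= galg_eltE eqxx mul1r big1 ?addr0 // => h /negPf ha.
by rewrite galg_eltE ha mul0r.
Qed.

Lemma mul_galg_eltr a x g : (x * <<a>>) g = x (g * a^-1)%g.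
Proof.
rewrite [LHS]ffunE (bigD1 (g * a^-1)%g) //= galg_eltE invMg invgK mulgKV eqxx mulr1.
rewrite big1 ?addr0 // => h ha; rewrite galg_eltE; case: eqP => [e|_]; last by rewrite mulr0.
by rewrite -e invMg invgK mulKVg eqxx in ha.
Qed.

Lemma galg_sumE x : x = \sum_h x h *: <<h>>.
Proof.
apply/ffunP=> g; rewrite sum_ffunE (bigD1 g) //= big1 ?addr0 => [|h hg].
  by rewrite ffunE galg_eltE eqxx /GRing.scale /= mulr1.
by rewrite ffunE galg_eltE eq_sym (negPf hg) scaler0.
Qed.

Lemma galg_elt1 : <<1>> = 1 :> kG. Proof. by []. Qed.

Lemma galg_eltM a b : <<a * b>> = <<a>> * <<b>> :> kG.
Proof.
by apply/ffunP=> g; rewrite mul_galg_eltl !galg_eltE -(inj_eq (mulgI a^-1)%g) mulKg.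
Qed.

Lemma galg_form1 x : galg_form x 1 = x 1%g.
Proof.
rewrite /galg_form (bigD1 1%g) //= big1 ?addr0 => [|h h1].
  by rewrite invg1 -galg_elt1 galg_eltE eqxx mulr1.
by rewrite -galg_elt1 galg_eltE invg_eq1 (negPf h1) mulr0.
Qed.

(** The linear extension of [P] from the group to kG: this is the meaning of inserting an element of
    kG as an argument. *)
Definition lext (V : lmodType k) (P : gT -> V) x : V := \sum_h x h *: P h.

Lemma lext_is_linear (V : lmodType k) (P : gT -> V) : linear (lext P).
Proof.
move=> c x y; rewrite /lext scaler_sumr -big_split; apply: eq_bigr => h _ /=.
by rewrite !ffunE scalerDl scalerA.
Qed.
HB.instance Definition _ (V : lmodType k) (P : gT -> V) :=
  GRing.isSemilinear.Build k kG V _ (lext P)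
    (GRing.semilinear_linear (@lext_is_linear V P)).

Lemma eq_lext (V : lmodType k) (P Q : gT -> V) x : P =1 Q -> lext P x = lext Q x.
Proof. by move=> PQ; apply: eq_bigr => h _; rewrite PQ. Qed.

Lemma lextZ (V : lmodType k) c (P : gT -> V) x :
  lext (fun h => c *: P h) x = c *: lext P x.
Proof. by rewrite /lext scaler_sumr; apply: eq_bigr => h _; rewrite !scalerA mulrC. Qed.

Lemma lextD (V : lmodType k) (P Q : gT -> V) x :
  lext (fun h => P h + Q h) x = lext P x + lext Q x.
Proof. by rewrite /lext -big_split; apply: eq_bigr => h _; rewrite scalerDr. Qed.

Lemma lextN (V : lmodType k) (P : gT -> V) x : lext (fun h => - P h) x = - lext P x.
Proof. by rewrite /lext -sumrN; apply: eq_bigr => h _; rewrite scalerN. Qed.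

Lemma lext_cst0 (V : lmodType k) x : lext (fun=> 0 : V) x = 0.
Proof. by rewrite /lext big1 // => h _; rewrite scaler0. Qed.

Lemma lext_eltl (V : lmodType k) (P : gT -> V) a x :
  lext P (<<a>> * x) = lext (fun h => P (a * h)%g) x.
Proof.
rewrite /lext (reindex_inj (mulgI a)) /=; apply: eq_bigr => h _.
by rewrite mul_galg_eltl mulKg.
Qed.

Lemma lext_eltr (V : lmodType k) (P : gT -> V) a x :
  lext P (x * <<a>>) = lext (fun h => P (h * a)%g) x.
Proof.
rewrite /lext (reindex_inj (mulIg a)) /=; apply: eq_bigr => h _.
by rewrite mul_galg_eltr mulgK.
Qed.

Lemma lext_mulr (P : gT -> kG) x y : lext (fun h => P h * y) x = lext P x * y.
Proof. by rewrite /lext mulr_suml; apply: eq_bigr => h _; apply: scalerAl. Qed.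

Lemma lext_mull (P : gT -> kG) x y : lext (fun h => y * P h) x = y * lext P x.
Proof. by rewrite /lext mulr_sumr; apply: eq_bigr => h _; apply: scalerAr. Qed.

Lemma lext_elt x : lext (fun h => <<h>>) x = x.
Proof. by symmetry; apply: galg_sumE. Qed.

Lemma lext_basis (V : lmodType k) (P : gT -> V) a : lext P <<a>> = P a.
Proof.
rewrite /lext (bigD1 a) //= galg_eltE eqxx scale1r big1 ?addr0 // => h /negPf ha.
by rewrite galg_eltE ha scale0r.
Qed.

End GroupAlgebraTheory.

(** * The Hochschild differential on functions of lists and its Leibniz rule *)

Section HochschildDifferential.
Variables (k : fieldType) (gT : finGroupType).
Local Notation kG := (galg k gT).
Local Notation "<< g >>" := (galg_elt k g).
Implicit Types (m n : nat) (a b g : gT) (s u : seq gT) (F G : seq gT -> kG).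

Definition head_mul F s : kG := if s is a :: s' then <<a>> * F s' else 0.
Definition last_mul F s : kG := if s is a :: s' then F (belast a s') * <<last a s'>> else 0.

Lemma last_mul_rcons F s a : last_mul F (rcons s a) = F s * <<a>>.
Proof. by case: s => //= b s; rewrite belast_rcons last_rcons. Qed.

(** The last sign follows the length of [s] instead of a degree; for a function of arity n the last
    term lives in length n+1, where this is the usual sign. *)
Definition hdiff F s : kG := head_mul F s + bar F s + (-1) ^+ size s *: last_mul F s.

Lemma head_mul_arity n F : arity n F -> arity n.+1 (head_mul F).
Proof. by move=> aF [|a s] //= sn; rewrite aF ?mulr0. Qed.

Lemma last_mul_arity n F : arity n F -> arity n.+1 (last_mul F).
Proof. by move=> aF [|a s] //= sn; rewrite aF ?mul0r // size_belast. Qed.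

Lemma hdiff_arity n F : arity n F -> arity n.+1 (hdiff F).
Proof.
move=> aF s sn; rewrite /hdiff (head_mul_arity aF) // (last_mul_arity aF) // (bar_arity aF) //.
by rewrite scaler0 !addr0.
Qed.

(** By [bar_one] the two merges of an inner letter 1 cancel. At an end of the list the missing merge
    is supplied by the outer term, since 1 acts trivially. *)
Lemma hdiff_normalized F : normalized F -> normalized (hdiff F).
Proof.
move=> nF s /path.splitPr[x y]; rewrite /hdiff bar_one //.
have -> : head_mul F (x ++ 1%g :: y) = (x == [::])%:R *: F (x ++ y).
  case: x => [|a x] /=; first by rewrite galg_elt1 mul1r scale1r.
  by rewrite nF ?mulr0 ?scale0r // mem_cat mem_head orbT.
have -> : last_mul F (x ++ 1%g :: y) = (y == [::])%:R *: F (x ++ y).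
  case/lastP: y => [|y a].
    by rewrite cats1 last_mul_rcons galg_elt1 mulr1 cats0 scale1r.
  have -> : x ++ 1%g :: rcons y a = rcons (x ++ 1%g :: y) a by rewrite rcons_cat.
  rewrite last_mul_rcons.
  rewrite nF ?mul0r ?mem_cat ?mem_head ?orbT //.
  by case: y => [|b y]; rewrite scale0r.
rewrite scalerA -!scalerDl size_cat /= addnS.
case: x => [|a x]; case: y => [|b y] /=; rewrite ?expr0 ?addn0 ?exprS -?scalerDl.
- by rewrite -[RHS](scale0r (F [::])); congr (_ *: _); ring.
- by rewrite -[RHS](scale0r (F (b :: y))); congr (_ *: _); ring.
- by rewrite -[RHS](scale0r (F (a :: x ++ [::]))); congr (_ *: _); ring.
- by rewrite -[RHS](scale0r (F (a :: x ++ b :: y))); congr (_ *: _); ring.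
Qed.

Lemma hdiffZ c F s : hdiff (fun u => c *: F u) s = c *: hdiff F s.
Proof.
rewrite /hdiff barZ !scalerDr scalerA [c * _]mulrC -scalerA; congr (_ + _ + _ *: _).
  by case: s => [|a s]; rewrite ?scaler0 //= -scalerAr.
by case: s => [|a s]; rewrite ?scaler0 //= -scalerAl.
Qed.

Lemma eq_hdiff F G s :
  (forall u, (size u).+1 = size s -> F u = G u) -> hdiff F s = hdiff G s.
Proof.
move=> FG; rewrite /hdiff (eq_bar FG) /head_mul /last_mul.
by case: s FG => //= a s FG; rewrite !FG ?size_belast.
Qed.

Lemma hdiff0 s : hdiff (fun=> 0) s = 0.
Proof.
rewrite /hdiff bar0; case: s => [|a s] /=; first by rewrite scaler0 !addr0.
by rewrite mulr0 mul0r scaler0 !addr0.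
Qed.

Lemma hdiffB F G s : hdiff (fun u => F u - G u) s = hdiff F s - hdiff G s.
Proof.
rewrite /hdiff (@eq_bar _ _ _ _ (fun u => F u + -1 *: G u)) => [|u _]; last first.
  by rewrite scaleN1r.
rewrite bar_add barZ scaleN1r.
case: s => [|a s] /=; first by rewrite !scaler0 !addr0 !add0r.
by rewrite mulrBr mulrBl scalerBr !opprD !addrA [LHS](ACl (1*3*5*2*4*6)).
Qed.

Definition cup n F G s : kG := F (take n s) * G (drop n s).

Lemma cup_arity n m F G : arity n F -> arity m G -> arity (n + m) (cup n F G).
Proof.
move=> aF aG s sn; have [ns|ns] := leqP n (size s); last first.
  by rewrite /cup aF ?mul0r // take_oversize; lia.
by rewrite /cup aG ?mulr0 // size_drop; lia.
Qed.

Lemma cup_normalized n F G : normalized F -> normalized G -> normalized (cup n F G).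
Proof.
move=> nF nG s; rewrite -{1}(cat_take_drop n s) mem_cat /cup.
by case/orP => s1; [rewrite nF ?mul0r | rewrite nG ?mulr0].
Qed.

(** [bar_split] separates the merges seen by [F] from those seen by [G]. The right side has two
    extra terms, the last of [hdiff F] and the first of [hdiff G], which cancel. *)
Lemma hdiff_cup n F G s : arity n F ->
  hdiff (cup n F G) s = cup n.+1 (hdiff F) G s + (-1) ^+ n *: cup n F (hdiff G) s.
Proof.
(* On lists of length at most [n] every term is zero, by arity or because [hdiff G] vanishes on the
   empty list. *)
move=> aF; have [ns|sn] := ltnP n (size s); last first.
  have cup0 u : (size u < n)%N -> cup n F G u = 0.
    by move=> un; rewrite /cup aF ?mul0r // take_oversize; lia.
  rewrite {2}/cup (hdiff_arity aF) ?mul0r ?take_oversize //; try lia.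
  rewrite /cup drop_oversize // /hdiff bar_nil /= scaler0 !addr0 mulr0 scaler0.
  rewrite (@eq_bar _ _ _ _ (fun=> 0)) ?bar0 ?addr0; last first.
    by move=> u us; apply: cup0; lia.
  case: s sn => [|a s] sn; rewrite ?scaler0 ?addr0 //=.
  by rewrite -!/(cup n F G _) !cup0 ?size_belast // mulr0 mul0r scaler0 addr0.
(* The letter [c] at the cut is the last one for [hdiff F] and the first one for [hdiff G]. *)
have [x [c [y [sE nE]]]] : exists x c y, s = x ++ c :: y /\ n = size x.
  exists (take n s), (nth 1%g s n), (drop n.+1 s).
  by rewrite -drop_nth // cat_take_drop size_takel // ltnW.
rewrite {1}/hdiff /cup.
rewrite (bar_split (fun u v => F u * G v)) sE nE.
have [-> ->] : take (size x) (x ++ c :: y) = x /\ drop (size x) (x ++ c :: y) = c :: y.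
  by rewrite take_size_cat ?drop_size_cat.
have [-> ->] : take (size x).+1 (x ++ c :: y) = rcons x c
               /\ drop (size x).+1 (x ++ c :: y) = y.
  by rewrite -cat_rcons take_size_cat ?drop_size_cat ?size_rcons.
rewrite /hdiff size_rcons last_mul_rcons !(mulrDl, mulrDr) !scalerDr.
have -> : head_mul (fun u => F (take (size x) u) * G (drop (size x) u)) (x ++ c :: y) =
    head_mul F (rcons x c) * G y.
  case: x {sE nE} => [|a x]; rewrite /= ?take0 ?drop0 ?mulrA //.
  by rewrite -cat_rcons take_size_cat ?drop_size_cat ?size_rcons.
have -> : last_mul (fun u => F (take (size x) u) * G (drop (size x) u)) (x ++ c :: y) =
    F x * last_mul G (c :: y).
  rewrite lastI -rcons_cat !last_mul_rcons -/size.
  by rewrite take_size_cat ?drop_size_cat // mulrA.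
have -> : bar (fun u => F u * G y) (rcons x c) = bar F (rcons x c) * G y.
  by rewrite /bar mulr_suml; apply: eq_bigr => i _; rewrite -scalerAl.
have -> : bar (fun u => F x * G u) (c :: y) = F x * bar G (c :: y).
  by rewrite /bar mulr_sumr; apply: eq_bigr => i _; rewrite scalerAr.
rewrite -[head_mul G (c :: y)]/(<<c>> * G y) size_cat exprD -scalerA -!scalerAr.
rewrite exprS -!scalerAl mulN1r scaleNr mulrA !addrA.
by rewrite addrNK.
Qed.

End HochschildDifferential.

(** * Circle products and the Gerstenhaber bracket *)

Section CircleProduct.
Variables (k : fieldType) (gT : finGroupType).
Local Notation kG := (galg k gT).
Local Notation "<< g >>" := (galg_elt k g).
Implicit Types (m n : nat) (a b g : gT) (s u : seq gT) (F G P : seq gT -> kG).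

Definition insert_at m P G s j : kG :=
  lext (fun h => P (take j s ++ h :: drop (j + m) s)) (G (take m (drop j s))).

(** The sum runs over all positions, whatever the arity of [P], so that it can be computed by
    recursion on the list; [circE] recovers the usual range. *)
Definition circ m P G s : kG :=
  \sum_(j < (size s).+1) (-1) ^+ (m.+1 * j) *: insert_at m P G s j.

Definition insert_head m P G s : kG :=
  lext (fun h => P (h :: drop m s)) (G (take m s)).

Lemma circ_nil m P G : circ m P G [::] = insert_head m P G [::].
Proof. by rewrite /circ big_ord1 muln0 scale1r. Qed.

Lemma circ_cons m P G a s :
  circ m P G (a :: s) =
  insert_head m P G (a :: s) + (-1) ^+ m.+1 *: circ m (fun u => P (a :: u)) G s.
Proof.
rewrite /circ big_ord_recl muln0 scale1r /insert_at take0 add0n drop0 /=.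
congr (_ + _); rewrite scaler_sumr; apply: eq_bigr => j _.
by rewrite mulnS exprD -scalerA.
Qed.

Lemma eq_circ m P Q G s :
  (forall u, u != [::] -> P u = Q u) -> circ m P G s = circ m Q G s.
Proof.
move=> PQ; apply: eq_bigr => j _; congr (_ *: _); apply: eq_lext => h.
by apply: PQ; case: (take _ _).
Qed.

Lemma circD m P Q G s : circ m (fun u => P u + Q u) G s = circ m P G s + circ m Q G s.
Proof.
by rewrite /circ -big_split; apply: eq_bigr => j _; rewrite /insert_at lextD scalerDr.
Qed.

Lemma circZ m c P G s : circ m (fun u => c *: P u) G s = c *: circ m P G s.
Proof.
rewrite /circ scaler_sumr; apply: eq_bigr => j _.
by rewrite /insert_at lextZ !scalerA mulrC.
Qed.

Lemma circN m P G s : circ m (fun u => - P u) G s = - circ m P G s.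
Proof.
by rewrite /circ -sumrN; apply: eq_bigr => j _; rewrite /insert_at lextN scalerN.
Qed.

Lemma circ_arity n m P G s : arity n P -> arity m G ->
  (size s).+1 != (n + m)%N -> circ m P G s = 0.
Proof.
move=> aP aG sn; rewrite /circ big1 // => j _; rewrite /insert_at.
have [tm|tm] := eqVneq (size (take m (drop j s))) m; last by rewrite aG // linear0 scaler0.
rewrite (eq_lext (Q := fun=> 0)) ?lext_cst0 ?scaler0 // => h; apply: aP.
move: tm (ltn_ord j); rewrite size_cat /= !size_take !size_drop.
case: ifP; case: ifP; lia.
Qed.

(** From position [n] on, fewer than [m] letters are left for [G], which then vanishes. *)
Lemma circE n m P G s : arity m G -> (size s).+1 = (n + m)%N ->
  circ m P G s = \sum_(j < n) (-1) ^+ (m.+1 * j) *: insert_at m P G s j.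
Proof.
move=> aG sn; rewrite /circ sn big_split_ord /= [X in _ + X]big1 ?addr0 // => j _.
rewrite /insert_at aG ?linear0 ?scaler0 // size_take size_drop.
by have := ltn_ord j; case: ifP; lia.
Qed.

Lemma circ_normalized m P G : normalized P -> normalized G -> normalized (circ m P G).
Proof.
move=> nP nG s s1; rewrite /circ big1 // => j _; rewrite /insert_at.
have [sm|sm] := boolP (1%g \in take m (drop j s)); first by rewrite nG // linear0 scaler0.
rewrite (eq_lext (Q := fun=> 0)) ?lext_cst0 ?scaler0 // => h; apply: nP.
move: s1; rewrite -{1}(cat_take_drop j s) -{1}(cat_take_drop m (drop j s)) drop_drop.
by rewrite !mem_cat (negPf sm) inE /= addnC => /orP[] ->; rewrite ?orbT.
Qed.

(** Inserting in the first argument multiplies by the value of [G], which is a cup product; later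
    insertions leave the first letter alone. *)
Lemma circ_head_mul m P G s :
  circ m (head_mul P) G s =
  G (take m s) * P (drop m s) + (-1) ^+ m.+1 *: head_mul (circ m P G) s.
Proof.
have head u : insert_head m (head_mul P) G u = G (take m u) * P (drop m u).
  by rewrite /insert_head /= lext_mulr lext_elt.
case: s => [|a s]; first by rewrite circ_nil head scaler0 addr0.
rewrite circ_cons head /=; congr (_ + _ *: _).
rewrite /circ mulr_sumr; apply: eq_bigr => j _.
by rewrite /insert_at lext_mull; apply: scalerAr.
Qed.

(** The mirror image of [circ_head_mul]: the insertion in the last argument, at position [n],
    produces the other cup product. *)
Lemma circ_last_mul n m P G s : arity n P -> arity m G ->
  circ m (last_mul P) G s = last_mul (circ m P G) s + (-1) ^+ (m.+1 * n) *: cup n P G s.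
Proof.
move=> aP aG; have [sn|sn] := eqVneq (size s) (n + m)%N; last first.
  rewrite (circ_arity (last_mul_arity aP) aG) ?addSn ?eqSS // (cup_arity aP aG) //.
  rewrite scaler0 addr0; case: s sn => //= a s sn.
  by rewrite (circ_arity aP aG) ?mul0r // size_belast.
rewrite (circE (n := n.+1)) ?sn // big_ord_recr /=; congr (_ + _ *: _); last first.
  rewrite /insert_at /cup drop_oversize ?sn //.
  rewrite (@take_oversize _ m) ?size_drop ?sn; last by lia.
  under eq_lext do rewrite cats1 last_mul_rcons.
  by rewrite lext_mull lext_elt.
case/lastP: s sn => [|s z] /= sn; first by case: n sn {aP} => // _; rewrite big_ord0.
rewrite size_rcons in sn; rewrite last_mul_rcons (circE (n := n)) // mulr_suml.
apply: eq_bigr => j _; rewrite -scalerAl /insert_at -lext_mulr; congr (_ *: _).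
have jn := ltn_ord j; rewrite !drop_rcons; try lia.
rewrite -!cats1 !takel_cat ?size_drop; try lia.
by apply: eq_lext => h; rewrite cats1 -rcons_cons -rcons_cat last_mul_rcons.
Qed.

Lemma bar_insert_head m P G s : arity m G ->
  bar (insert_head m P G) s =
  insert_head m.+1 P (bar G) s
  + (-1) ^+ m *: lext (fun h => bar (fun u => P (h :: u)) (drop m s)) (G (take m s)).
Proof.
move=> aG.
rewrite (bar_split (fun u v => lext (fun h => P (h :: v)) (G u))).
congr (_ + _ *: _).
  by rewrite /insert_head /bar linear_sum; apply: eq_bigr => i _; rewrite linearZ.
by rewrite /lext bar_sum.
Qed.

(** Multiplying the value of [G] by [a] amounts to merging [a] with the inserted letter. Thus the
    first term of [hdiff G] becomes a merge inside the arguments of [P]; [insert_head_last_mul] does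
    the same for the last term. *)
Lemma insert_head_head_mul m P G a s :
  insert_head m.+1 P (head_mul G) (a :: s) = - insert_head m (bar_head P a) G s.
Proof. by rewrite /insert_head /= lext_eltl lextN opprK. Qed.

Lemma insert_head_last_mul m P G s : arity m G ->
  (-1) ^+ size (take m.+1 s) *: insert_head m.+1 P (last_mul G) s =
  (-1) ^+ m *: lext (fun h => bar_head P h (drop m s)) (G (take m s)).
Proof.
move=> aG; have [sm|ms] := leqP (size s) m.
  rewrite drop_oversize //= lext_cst0 scaler0 /insert_head.
  rewrite (last_mul_arity aG) ?linear0 ?scaler0 //.
  by rewrite take_oversize; lia.
rewrite /insert_head (take_nth 1%g ms) (drop_nth 1%g ms) last_mul_rcons size_rcons.
by rewrite size_takel 1?ltnW // lext_eltr lextN scalerN exprS mulN1r scaleNr.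
Qed.

(** Insertions behind the first letter commute with merging [a] into it, so they drop out of the
    difference. *)
Lemma bar_head_circ m P G a s :
  bar_head (circ m P G) a s - circ m (bar_head P a) G s =
  bar_head (insert_head m P G) a s - insert_head m (bar_head P a) G s.
Proof.
case: s => [|b s]; first by rewrite circ_nil.
rewrite [bar_head (circ _ _ _) _ _]/= !circ_cons circN scalerN /= !opprD.
by rewrite addrACA opprK addNr addr0.
Qed.

(* [circ^~ G] is the transpose of the coderivation of the bar coalgebra extending [G],
   and [bar], up to sign, that of the one extending the product: their graded commutator
   is again such a transpose, and [hdiff G] is what it extends. *)
Lemma bar_circ m P G s : arity m G ->
  bar (circ m P G) s =
  (-1) ^+ m.+1 *: circ m (bar P) G s + circ m.+1 P (hdiff G) s.
Proof.
move=> aG; elim: s P => [|a s IH] P.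
  rewrite bar_nil !circ_nil /insert_head /= /hdiff bar_nil /= scaler0 !addr0 linear0 addr0.
  under eq_lext do rewrite bar_1.
  by rewrite lext_cst0 scaler0.
have -> : bar (circ m P G) (a :: s) =
    bar (insert_head m P G) (a :: s) - insert_head m (bar_head P a) G s
    + circ m (bar_head P a) G s - (-1) ^+ m.+1 *: bar (circ m (fun u => P (a :: u)) G) s.
  rewrite !bar_cons (@eq_bar _ _ _ (fun u => circ m P G (a :: u))
    (fun u => insert_head m P G (a :: u)
              + (-1) ^+ m.+1 *: circ m (fun v => P (a :: v)) G u)) => [|u _]; last first.
    exact: circ_cons.
  rewrite bar_add barZ opprD addrA; congr (_ - _).
  by rewrite [_ - _ - insert_head _ _ _ _]addrAC -bar_head_circ addrAC subrK.
rewrite bar_insert_head // IH !circ_cons.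
have -> : circ m (fun u => bar P (a :: u)) G s =
    circ m (bar_head P a) G s - circ m (bar (fun u => P (a :: u))) G s.
  rewrite -circN -circD; apply: eq_circ => u _; exact: bar_cons.
have -> : insert_head m (bar P) G (a :: s) =
    lext (fun h => bar_head P h (drop m (a :: s))) (G (take m (a :: s)))
    - lext (fun h => bar (fun u => P (h :: u)) (drop m (a :: s))) (G (take m (a :: s))).
  by rewrite -lextN -lextD; apply: eq_lext => h; apply: bar_cons.
have -> : insert_head m.+1 P (hdiff G) (a :: s) =
    - insert_head m (bar_head P a) G s + insert_head m.+1 P (bar G) (a :: s)
    + (-1) ^+ m *: lext (fun h => bar_head P h (drop m (a :: s))) (G (take m (a :: s))).
  by rewrite -insert_head_head_mul -insert_head_last_mul // /insert_head !linearD linearZ.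
rewrite -[(-1) ^+ m.+2]signr_odd -[(-1) ^+ m.+1]signr_odd -[(-1) ^+ m]signr_odd /=.
(* The algebra kG need not be commutative, so [ring] is applied to coefficients in [k], after the
   signs have been reduced to parities. *)
apply/ffunP => g; rewrite !ffunE /GRing.scale /=.
by case: (odd m); rewrite /= ?expr0 ?expr1; ring.
Qed.

Lemma hdiffE n P s : arity n P ->
  hdiff P s = head_mul P s + bar P s + (-1) ^+ n.+1 *: last_mul P s.
Proof.
move=> aP; have [sn|sn] := eqVneq (size s) n.+1; first by rewrite /hdiff sn.
by rewrite /hdiff (last_mul_arity aP) ?scaler0.
Qed.

(** The inner terms are [bar_circ]. The cup products arise because [hdiff P] has outer terms whose
    end argument can receive [G]. *)
Lemma hdiff_circ n m P G s : arity n P -> arity m G -> size s = (n + m)%N ->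
  hdiff (circ m P G) s =
  circ m.+1 P (hdiff G) s + (-1) ^+ m.+1 *: circ m (hdiff P) G s
  + (-1) ^+ m *: cup m G P s - (-1) ^+ (m * n.+1) *: cup n P G s.
Proof.
move=> aP aG sn; rewrite /hdiff bar_circ // -/(hdiff _) sn.
rewrite (@eq_circ _ (hdiff P)
  (fun u => head_mul P u + bar P u + (-1) ^+ n.+1 *: last_mul P u)) => [|u _]; last first.
  exact: hdiffE.
rewrite !circD circZ circ_head_mul (circ_last_mul _ aP aG) -/(cup m G P s).
rewrite -[(-1) ^+ (n + m)]signr_odd -[(-1) ^+ m.+1]signr_odd -[(-1) ^+ m]signr_odd.
rewrite -[(-1) ^+ n.+1]signr_odd -[(-1) ^+ (m.+1 * n)]signr_odd.
rewrite -[(-1) ^+ (m * n.+1)]signr_odd !oddM oddD /=.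
apply/ffunP => g; rewrite !ffunE /GRing.scale /=.
by case: (odd m); case: (odd n); rewrite /= ?expr0 ?expr1; ring.
Qed.

Definition lie n m F G s : kG := circ m F G s - (-1) ^+ (n.+1 * m.+1) *: circ n G F s.

Lemma lie_skew n m F G s : lie n m F G s = - (-1) ^+ (n.+1 * m.+1) *: lie m n G F s.
Proof.
rewrite /lie [(m.+1 * _)%N]mulnC scaleNr scalerBr scalerA -expr2 sqrr_sign scale1r.
by rewrite opprB.
Qed.

Lemma lie_arity n m F G s : arity n F -> arity m G ->
  (size s).+1 != (n + m)%N -> lie n m F G s = 0.
Proof.
move=> aF aG sn; rewrite /lie (circ_arity aF aG sn) (circ_arity aG aF) ?scaler0 ?subr0 //.
by rewrite addnC.
Qed.

Lemma lie_normalized n m F G : normalized F -> normalized G -> normalized (lie n m F G).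
Proof.
move=> nF nG s s1.
by rewrite /lie !circ_normalized ?scaler0 ?subr0.
Qed.

Lemma eq_lie n m (F F' G G' : seq gT -> kG) s :
  F =1 F' -> G =1 G' -> lie n m F G s = lie n m F' G' s.
Proof.
have eq_circ2 m' (P P' Q Q' : seq gT -> kG) :
    P =1 P' -> Q =1 Q' -> circ m' P Q s = circ m' P' Q' s.
  move=> eP eQ; rewrite (eq_circ _ (Q := P')) => [|u _]; last exact: eP.
  by apply: eq_bigr => j _; rewrite /insert_at eQ.
by move=> eF eG; rewrite /lie !(eq_circ2 _ F F' G G', eq_circ2 _ G G' F F').
Qed.

Lemma lie0r n m (F : seq gT -> kG) s : lie n m F (fun=> 0) s = 0.
Proof.
rewrite /lie /circ !big1 ?scaler0 ?subr0 // => j _; rewrite /insert_at ?linear0 ?scaler0 //.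
by rewrite lext_cst0 scaler0.
Qed.

Lemma lie0l n m (G : seq gT -> kG) s : lie n m (fun=> 0) G s = 0.
Proof. by rewrite lie_skew lie0r scaler0. Qed.

Lemma lieBr n m (F G G' : seq gT -> kG) s :
  lie n m F (fun u => G u - G' u) s = lie n m F G s - lie n m F G' s.
Proof.
rewrite /lie; have -> : circ m F (fun u => G u - G' u) s = circ m F G s - circ m F G' s.
  by rewrite /circ -sumrB; apply: eq_bigr => j _; rewrite /insert_at linearB scalerBr.
by rewrite circD circN scalerBr !opprD !opprK !addrA [LHS](ACl (1*3*2*4)).
Qed.

Lemma lieBl n m (F F' G : seq gT -> kG) s :
  lie n m (fun u => F u - F' u) G s = lie n m F G s - lie n m F' G s.
Proof. by rewrite !(lie_skew n m) lieBr scalerBr. Qed.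

(** The two circle products contribute the same two cup products, and the sign of the bracket
    cancels them. *)
Lemma hdiff_lie n m F G s : arity n F -> arity m G -> size s = (n + m)%N ->
  hdiff (lie n m F G) s =
  lie n m.+1 F (hdiff G) s + (-1) ^+ m.+1 *: lie n.+1 m (hdiff F) G s.
Proof.
move=> aF aG sn; rewrite /lie hdiffB hdiffZ (hdiff_circ aF aG sn).
rewrite (hdiff_circ aG aF); last by rewrite addnC.
rewrite -[(-1) ^+ (n.+1 * m.+1)]signr_odd -[(-1) ^+ m.+1]signr_odd -[(-1) ^+ m]signr_odd.
rewrite -[(-1) ^+ n.+1]signr_odd -[(-1) ^+ n]signr_odd -[(-1) ^+ (m * n.+1)]signr_odd.
rewrite -[(-1) ^+ (n * m.+1)]signr_odd -[(-1) ^+ (n.+1 * m.+2)]signr_odd.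
rewrite -[(-1) ^+ (n.+2 * m.+1)]signr_odd !oddM /=.
apply/ffunP => g; rewrite !ffunE /GRing.scale /=.
by case: (odd m); case: (odd n); rewrite /= ?expr0 ?expr1; ring.
Qed.

End CircleProduct.

(** * The BV operator *)

Section CyclicNorm.
Variables (k : fieldType) (gT : finGroupType).
Local Notation kG := (galg k gT).
Local Notation "<< g >>" := (galg_elt k g).
Implicit Types (m n : nat) (a b g : gT) (s t u : seq gT) (F : seq gT -> kG).
Implicit Types (phi : seq gT -> k^o).

(** The norm operator of cyclic homology: a rotation by one of a list of length p+1 carries the sign
    (-1)^p. *)
Definition cyc_norm phi t : k^o :=
  \sum_(i < size t) (-1) ^+ (i * (size t).-1) *: phi (rot i t).

(** With T the signed rotation, this is the identity N(1 - T) = 0; the sum telescopes cyclically. *)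
Lemma cyc_norm_cyclic phi t :
  cyc_norm (fun u => phi u + (-1) ^+ size u *: phi (rotr 1 u)) t = 0.
Proof.
case: t => [|a t]; first by rewrite /cyc_norm big_ord0.
rewrite /cyc_norm [size _]/=.
under eq_bigr do rewrite scalerDr scalerA size_rot.
(* The last term of the first sum and the first term of the second form the wrap-around pair; the
   others cancel after a shift by one. *)
rewrite big_split /= [in X in X + _]big_ord_recr big_ord_recl /=.
rewrite [LHS](AC (2 * 2) ((1 * 4) * (2 * 3))) -big_split big1 /= ?add0r => [|i _].
  rewrite mul0n rot0 expr0 mul1r /rotr /= subn1 -scalerDl.
  rewrite -[X in X + _]signr_odd -[X in _ + X]signr_odd oddM andbb /=.
  by case: (odd _); rewrite ?expr0 ?expr1 ?subrr ?addNr scale0r.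
rewrite /bump leq0n add1n rotS; last by rewrite ltnS ltnW.
have -> : (-1) ^+ (i.+1 * size t) * (-1) ^+ (size t).+1 = - (-1) ^+ (i * size t) :> k.
  rewrite -exprD -[RHS]mulN1r -exprS; apply: eq_sign.
  by rewrite mulSn /= !oddD /=; case: (odd (size t)); case: (odd _).
by rewrite rotK -scalerDl subrr scale0r.
Qed.

(* Merging two cyclically adjacent letters commutes with rotation; the merge across the
   two ends of the list is the term at [rcons s (b * a)]. *)
Lemma bar_cyc_norm phi a s b :
  bar (cyc_norm phi) (a :: rcons s b) + cyc_norm phi (rcons s (b * a)%g) =
  cyc_norm (bar phi) (a :: rcons s b).
Proof.
set t := a :: _; set n := (size s).+1.
have tn : size t = n.+1 by rewrite /= size_rcons.
rewrite (@eq_bar _ _ _ _ (fun u => \sum_(i < n)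
  (-1) ^+ (i * n.-1) *: phi (drop i u ++ take i u))) => [|u]; last first.
  by rewrite tn => -[un]; rewrite /cyc_norm un.
rewrite bar_sum.
under eq_bigr => i _ do rewrite (bar_split (fun u v => phi (v ++ u))) scalerDr scalerA -exprD.
rewrite big_split /= /cyc_norm tn size_rcons -/n.
pose T1 i := (-1) ^+ (i * n) *: bar (fun u => phi (u ++ take i t)) (drop i t) : k^o.
(* [T1 n] has only one letter to merge in, hence is zero; this allows the shift to rotations by
   [i.+1]. *)
have eT1 : \sum_(i < n) T1 i = T1 0 + \sum_(i < n) T1 i.+1.
  transitivity (\sum_(i < n.+1) T1 i); last by rewrite big_ord_recl.
  have T1n : T1 n = 0.
    rewrite /T1; have -> : drop n t = [:: b] by rewrite /= drop_rcons // drop_size.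
    by rewrite bar_1 scaler0.
  by rewrite [RHS]big_ord_recr -[LHS]addr0; congr (_ + _); apply/esym/T1n.
rewrite [RHS]big_ord_recl /=.
have -> : (-1) ^+ (0 * n) *: bar phi (rot 0 t) = T1 0.
  by rewrite /T1 mul0n rot0 drop0; congr (_ *: _); apply: eq_bar => u; rewrite take0 cats0.
have eT2 : \sum_(i < n) (-1) ^+ (i * n.-1 + i) *: bar (fun u => phi (u ++ take i t)) (drop i t)
    = \sum_(i < n) T1 i.
  by apply: eq_bigr => i _; rewrite -mulnSr prednK.
rewrite eT2 eT1 -addrA addrCA -!addrA; congr (_ + _).
rewrite addrCA -!big_split /=; apply: eq_bigr => i _.
have si : (i <= size s)%N by rewrite -ltnS.
rewrite /T1 /bump leq0n add1n /rot /= !drop_rcons //.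
have tk c : take i (rcons s c) = take i s by rewrite -cats1 takel_cat.
(* Rotation by [i.+1] puts [b] just before [a]. Cutting there leaves the merges on each side and the
   merge [b * a], which gives the rotation by [i] of [rcons s (b * a)]. *)
rewrite !tk bar_cat scalerDr scalerA scalerDr size_drop cat_rcons -exprD.
have -> : (-1) ^+ (i.+1 * n + (size s - i).+1) = (-1) ^+ (i * size s) :> k.
  apply: eq_sign; rewrite mulSn mulnS !oddD oddM /= oddB //.
  by case: (odd i); case: (odd (size s)).
by rewrite addrC -addrA.
Qed.

Lemma cyc_normD phi psi t :
  cyc_norm (fun u => phi u + psi u) t = cyc_norm phi t + cyc_norm psi t.
Proof. by rewrite /cyc_norm -big_split; apply: eq_bigr => i _; rewrite scalerDr. Qed.

Lemma eq_cyc_norm phi psi t :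
  (forall u, size u = size t -> phi u = psi u) -> cyc_norm phi t = cyc_norm psi t.
Proof. by move=> e; apply: eq_bigr => i _; rewrite e // size_rot. Qed.

Lemma bar_coef F g s : bar F s g = bar (fun u => F u g : k^o) s.
Proof. by rewrite /bar sum_ffunE; apply: eq_bigr => i _; rewrite ffunE. Qed.

(** The coefficient at 1 is a trace, so the two outer terms of [hdiff] are rotations of each other;
    [cyc_norm_cyclic] kills them. *)
Lemma cyc_norm_hdiff F t :
  cyc_norm (fun u => hdiff F u 1%g) t = cyc_norm (bar (fun u => F u 1%g : k^o)) t.
Proof.
rewrite -[RHS]addr0 -(cyc_norm_cyclic (fun u => head_mul F u 1%g) t) -cyc_normD.
apply: eq_cyc_norm => u _; rewrite /hdiff !ffunE bar_coef addrCA -addrA.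
congr (_ + (_ + _ *: _)).
case/lastP: u => [|u a] //.
rewrite last_mul_rcons rotr1_rcons /= mul_galg_eltl mul_galg_eltr.
by rewrite mul1g mulg1.
Qed.

(** The outer sign appears because [cyc_norm] counts rotations from 0 and the BV operator from 1. *)
Definition bv_fun F s : kG :=
  [ffun g => (-1) ^+ size s *: cyc_norm (fun u => F u 1%g) (rcons s g^-1%g)].

(** In [bar_cyc_norm] for the list [s] followed by the inverse of [g], the merges of that last
    letter with its two cyclic neighbours are the outer terms of the differential: translating a
    coefficient of kG multiplies the inverse of [g] by an end letter of [s]. *)
Lemma hdiff_bv_fun F s : hdiff (bv_fun F) s = - bv_fun (hdiff F) s.
Proof.
apply/ffunP => g; rewrite [RHS]ffunE [bv_fun _ _ _]ffunE cyc_norm_hdiff.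
case/lastP: s => [|s c].
  by rewrite /hdiff bar_nil /= scaler0 !addr0 ffunE /cyc_norm big_ord1 bar_1 !scaler0 oppr0.
have [a [x sE]] : exists a, exists x, rcons s c = a :: x.
  by case: s => [|a s]; [exists c, [::] | exists a, (rcons s c)].
have xs : size x = size s by have := congr1 size sE; rewrite size_rcons => -[].
rewrite {3}sE rcons_cons -bar_cyc_norm -rcons_cons -sE bar_rcons.
rewrite {1}/hdiff !ffunE last_mul_rcons mul_galg_eltr bar_coef sE [head_mul _ _]/=.
rewrite mul_galg_eltl -sE size_rcons !ffunE !invMg !invgK xs.
rewrite (@eq_bar _ _ _ _ (fun u => (-1) ^+ size s *:
  cyc_norm (fun v => F v 1%g) (rcons u g^-1%g))) => [|u]; last first.
  by rewrite size_rcons => -[us]; rewrite ffunE us.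
rewrite barZ /GRing.scale /=.
rewrite -[(-1) ^+ size s]signr_odd -[(-1) ^+ (size s).+1]signr_odd /=.
by case: (odd (size s)); rewrite /= ?expr0 ?expr1; ring.
Qed.

Lemma cyc_norm_normalized phi g s : normalized phi -> 1%g \in s ->
  cyc_norm phi (rcons s g) = 0.
Proof.
move=> nphi s1; rewrite /cyc_norm big1 // => i _; rewrite nphi ?scaler0 //.
by rewrite mem_rot mem_rcons inE s1 orbT.
Qed.

End CyclicNorm.

(** * Cochains as functions of lists *)

Section Evaluation.
Variables (k : fieldType) (gT : finGroupType) (V : vectType k) (n : nat).
Implicit Types (f : cochain gT V n) (s : seq gT).

(* Unlike [cev], [ev f] vanishes on the lists of length other than [n]. *)
Definition ev f s : V := if size s == n then cev f s else 0.

Lemma ev_arity f : arity n (ev f).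
Proof. by move=> s /negPf; rewrite /ev => ->. Qed.

Lemma evE f s : size s = n -> ev f s = cev f s.
Proof. by rewrite /ev => ->; rewrite eqxx. Qed.

Lemma ev_val f (t : n.-tuple (gbar gT)) : ev f (map val t) = f t.
Proof. by rewrite evE ?size_map ?size_tuple // /cev map_pK ?valK //; apply: valK. Qed.

Lemma tuple_gbar s : size s = n -> 1%g \notin s ->
  exists t : n.-tuple (gbar gT), s = map val t.
Proof.
move=> sn s1; have e : map val (pmap insub s : seq (gbar gT)) = s.
  rewrite (pmap_filter (insubK _)); apply/all_filterP/allP => g gs.
  rewrite /=; case: insubP => //= /negPn /eqP e; by rewrite -e gs in s1.
have sz : size (pmap insub s : seq (gbar gT)) == n by rewrite -(size_map val) e sn.
by exists (Tuple sz).
Qed.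

Lemma ev_normalized f : normalized (ev f).
Proof.
move=> s s1; rewrite /ev /cev; case: eqP => // sn; case: insubP => // t /eqP sz _.
have: all [eta insub : gT -> option (gbar gT)] s by rewrite all_count -size_pmap sz sn.
by move/allP/(_ _ s1); rewrite /=; case: insubP => //= u; rewrite eqxx.
Qed.

Lemma eq_cochain f g :
  (forall s, size s = n -> 1%g \notin s -> ev f s = ev g s) -> f = g.
Proof.
move=> fg; apply/ffunP => t; rewrite -!ev_val fg ?size_map ?size_tuple //.
by apply/mapP => -[[h h1] _ /= e]; rewrite -e eqxx in h1.
Qed.

(** [mkcochain] sees only lists of [n] letters different from 1; arity and normalization extend the
    agreement to all lists. *)
Lemma ev_mkcochain (F G : seq gT -> V) : arity n G -> normalized G ->
  (forall s, size s = n -> 1%g \notin s -> F s = G s) -> ev (mkcochain n F) =1 G.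
Proof.
move=> aG nG FG s; have [sn|sn] := eqVneq (size s) n; last by rewrite !(ev_arity, aG).
have [s1|s1] := boolP (1%g \in s); first by rewrite ev_normalized // nG.
rewrite -FG //; have [t e] := tuple_gbar sn s1.
by rewrite e ev_val ffunE.
Qed.

Lemma evB f g s : ev (f - g) s = ev f s - ev g s.
Proof.
rewrite /ev; case: eqP => _; last by rewrite subr0.
by rewrite -scaleN1r addrC cev_linear scaleN1r addrC.
Qed.

Lemma ev0 s : ev 0 s = 0.
Proof. by rewrite -[0 in LHS](subrr 0) evB subrr. Qed.

Lemma evZ c f s : ev (c *: f) s = c *: ev f s.
Proof.
have := ev0 s; rewrite -[c *: f]addr0 /ev; case: eqP => _ e; last by rewrite scaler0.
by rewrite cev_linear e addr0.
Qed.

End Evaluation.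

(** * The cochain operations agree with those on functions of lists *)

Section OperationsAsFunctions.
Variables (k : fieldType) (gT : finGroupType).
Local Notation kG := (galg k gT).
Local Notation C := (cochain gT kG).
Local Notation "<< g >>" := (galg_elt k g).
Implicit Types (n m : nat) (s : seq gT).

Lemma ev_hoch_diff n (f : C n) : ev (hoch_diff f) =1 hdiff (ev f).
Proof.
apply: ev_mkcochain; first exact/hdiff_arity/ev_arity.
  exact/hdiff_normalized/ev_normalized.
move=> s sn _; rewrite /hdiff /bar sn; congr (_ + _ + _ *: _).
- by case: s sn => //= a s [sn]; rewrite drop0 evE.
- apply: eq_big_nat => i; rewrite -sn => /size_merge_at; rewrite sn => -[si].
  by rewrite evE.
- case/lastP: s sn => // s a; rewrite size_rcons => -[sn].
  by rewrite last_mul_rcons evE // -cats1 take_size_cat // nth_cat sn ltnn subnn.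
Qed.

Lemma ev_hoch_cup n m (f : C n) (g : C m) : ev (hoch_cup f g) =1 cup n (ev f) (ev g).
Proof.
apply: ev_mkcochain; first exact/cup_arity/ev_arity/ev_arity.
  exact/cup_normalized/ev_normalized/ev_normalized.
move=> s sn _; rewrite /cup !evE // ?size_drop ?size_takel; lia.
Qed.

Lemma hoch_compE n m (f : C n) (g : C m) s : (size s).+1 = (n + m)%N ->
  hoch_comp f g s = circ m (ev f) (ev g) s.
Proof.
move=> sn; rewrite (circE (n := n)) //; last exact: ev_arity.
rewrite /hoch_comp big_add1 big_mkord; apply: eq_bigr => -[j /= jn] _; congr (_ *: _).
rewrite /hoch_comp_at /insert_at /lext /= evE; last first.
  by rewrite size_take size_drop; case: ifP; lia.
by apply: eq_bigr => h _; rewrite evE // size_cat /= size_take size_drop; case: ifP; lia.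
Qed.

Lemma ev_hoch_bracket n m (f : C n) (g : C m) :
  ev (hoch_bracket f g) =1 lie n m (ev f) (ev g).
Proof.
apply: ev_mkcochain.
- by move=> s sn; apply: lie_arity; try exact: ev_arity; lia.
- exact/lie_normalized/ev_normalized/ev_normalized.
(* In degrees 0 and 0 the target degree is truncated, and both sides are zero. *)
move=> s sn _; have [nm|nm] := posnP (n + m).
  move: nm f g => /eqP; rewrite addn_eq0 => /andP[/eqP-> /eqP->] f g.
  by rewrite lie_arity /hoch_comp ?big_geq ?scaler0 ?subr0 //; apply: ev_arity.
by rewrite /lie !hoch_compE // sn; lia.
Qed.

Lemma bv_fun_arity n (F : seq gT -> kG) s :
  arity n F -> (size s).+1 != n -> bv_fun F s = 0.
Proof.
move=> aF sn; apply/ffunP => g; rewrite !ffunE /cyc_norm big1 ?scaler0 // => i _.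
by rewrite aF ?ffunE ?scaler0 // size_rot size_rcons.
Qed.

Lemma bv_fun_normalized (F : seq gT -> kG) : normalized F -> normalized (bv_fun F).
Proof.
move=> nF s s1; apply/ffunP => g; rewrite !ffunE cyc_norm_normalized ?scaler0 //.
by move=> u u1; rewrite nF ?ffunE.
Qed.

Lemma ev_hoch_bv n (f : C n) : ev (hoch_bv f) =1 bv_fun (ev f).
Proof.
case: n f => [|p] f.
  by move=> s; rewrite ev0 (@bv_fun_arity 0) //; apply: ev_arity.
apply: ev_mkcochain.
- by move=> s sn; apply: bv_fun_arity; [apply: ev_arity | rewrite eqSS].
- exact/bv_fun_normalized/ev_normalized.
move=> s sn _; rewrite [RHS]galg_sumE [RHS](reindex_inj invg_inj) /=.
apply: eq_bigr => g _; rewrite -scaler_suml; congr (_ *: _).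
rewrite ffunE invgK /cyc_norm scaler_sumr size_rcons sn big_add1 big_mkord /=.
apply: eq_bigr => i _; rewrite galg_form1 mulSn exprD -mulrA evE //.
by rewrite size_rot size_rcons sn.
Qed.

End OperationsAsFunctions.

(** * Hochschild cohomology *)

Section InducedTheory.
Variables (k : fieldType) (V1 V2 : vectType k).
Variables (Z1 B1 : {vspace V1}) (Z2 B2 : {vspace V2}).

Lemma sqrep_class (u : V1) : u \in Z1 -> sqrep (sqclass Z1 B1 u) - u \in B1.
Proof. by move=> uZ; rewrite -(sqclass_eq _ (sqrep_mem _) uZ) sqrepK. Qed.

(** The chosen representative differs from [u] by an element of both [Z1] and [B1], which [F] sends
    into [B2]. *)
Lemma induces1_sqlift (F : V1 -> V2) :
  {morph F : u v / u - v} -> {in Z1, forall u, F u \in Z2} ->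
  {in Z1, forall u, u \in B1 -> F u \in B2} ->
  induces1 F (sqlift1 F : subquot Z1 B1 -> subquot Z2 B2).
Proof.
move=> FB FZ FcB u uZ; split; first exact: FZ.
apply/eqP; rewrite sqclass_eq ?FZ ?sqrep_mem // -FB.
by apply: FcB; [rewrite rpredB ?sqrep_mem | apply: sqrep_class].
Qed.

End InducedTheory.

Lemma induces2_sqlift (k : fieldType) (V1 V2 V3 : vectType k)
    (Z1 B1 : {vspace V1}) (Z2 B2 : {vspace V2}) (Z3 B3 : {vspace V3})
    (F : V1 -> V2 -> V3) :
  (forall v, {morph F^~ v : u u' / u - u'}) -> (forall u, {morph F u : v v' / v - v'}) ->
  (forall u v, u \in Z1 -> v \in Z2 -> F u v \in Z3) ->
  (forall u v, u \in B1 -> v \in Z2 -> F u v \in B3) ->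
  (forall u v, u \in Z1 -> v \in B2 -> F u v \in B3) ->
  induces2 F (sqlift2 F : subquot Z1 B1 -> subquot Z2 B2 -> subquot Z3 B3).
Proof.
move=> FBl FBr FZ FcBl FcBr u v uZ vZ; split; first exact: FZ.
apply/eqP; rewrite sqclass_eq ?FZ ?sqrep_mem //.
set u' := sqrep _; set v' := sqrep _.
(* F u' v' - F u v = F (u' - u) v' + F u (v' - v). *)
rewrite -(subrK (F u v') (F u' v')) -addrA -FBl -FBr.
by apply: rpredD; [apply: FcBl | apply: FcBr] => //; rewrite ?sqrep_mem ?sqrep_class.
Qed.

Section Complex.
Variables (k : fieldType) (C : nat -> vectType k).
Variable d : forall n, {linear C n -> C n.+1}.

Lemma cocyclesP n (u : C n) : reflect (d n u = 0) (u \in cocycles d n).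
Proof. by rewrite memv_ker lfunE; apply: eqP. Qed.

Lemma coboundaries0 (u : C 0) : u \in coboundaries d 0 -> u = 0.
Proof. by rewrite memv0 => /eqP. Qed.

Lemma coboundariesSP n (u : C n.+1) :
  reflect (exists w, u = d n w) (u \in coboundaries d n.+1).
Proof.
apply: (iffP memv_imgP) => [[w _ ->]|[w ->]]; exists w; rewrite ?lfunE //.
exact: memvf.
Qed.

End Complex.

(** * The operations descend to Hochschild cohomology *)

Section HochschildCohomology.
Variables (k : fieldType) (gT : finGroupType).
Local Notation kG := (galg k gT).
Local Notation C := (cochain gT kG).
Local Notation CV := (fun n => cochain gT kG n : vectType k).
Local Notation dH := (fun i => @hoch_diff k gT i : {linear _ -> _}).
Local Notation Z n := (cocycles (C := CV) dH n).
Local Notation B n := (coboundaries (C := CV) dH n).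

Lemma hoch_cocycleP n (f : C n) : f \in Z n <-> (forall s, hdiff (ev f) s = 0).
Proof.
split=> [/cocyclesP df s|df]; first by rewrite -ev_hoch_diff [hoch_diff f]df ev0.
apply/cocyclesP/eq_cochain => s _ _.
by rewrite [LHS]ev_hoch_diff df [RHS]ev0.
Qed.

(** The equation on [p] avoids casts between degrees such as [(n + p.+1).-1] and [n + p]. For
    [n = 0] it covers [u = 0], since [hdiff] vanishes on the empty list. *)
Lemma hoch_coboundary n p (w : C p) (u : C n) : p = n.-1 ->
  (forall s, size s = n -> ev u s = hdiff (ev w) s) -> u \in B n.
Proof.
move=> pn; case: n u pn => [|n] u pn; last first.
  rewrite {}pn {p} /= in w *; move=> uw; apply/coboundariesSP; exists w.
  by apply: eq_cochain => s sn _; rewrite uw // [RHS]ev_hoch_diff.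
move=> uw; rewrite /coboundaries memv0; apply/eqP/eq_cochain => s sn _.
rewrite uw // [RHS]ev0; case: s sn => // _.
by rewrite /hdiff bar_nil /= scaler0 !addr0.
Qed.

Lemma hoch_coboundary_ind n (Q : C n -> Prop) :
  (n = 0%N -> Q 0) ->
  (forall p (w : C p), n = p.+1 ->
    forall u : C n, (forall s, ev u s = hdiff (ev w) s) -> Q u) ->
  forall u, u \in B n -> Q u.
Proof.
move=> Q0 QS u; case: n Q Q0 QS u => [|n] Q Q0 QS u; first by move/coboundaries0->; apply: Q0.
by case/coboundariesSP=> w ->; apply: (QS n w) => // s; apply: ev_hoch_diff.
Qed.

Lemma hoch_cupBl n m (v : C m) : {morph (@hoch_cup k gT n m)^~ v : u u' / u - u'}.
Proof.
move=> u u'; apply: eq_cochain => s _ _.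
by rewrite [RHS]evB !ev_hoch_cup /cup evB mulrBl.
Qed.

Lemma hoch_cupBr n m (u : C n) : {morph @hoch_cup k gT n m u : v v' / v - v'}.
Proof.
move=> v v'; apply: eq_cochain => s _ _.
by rewrite [RHS]evB !ev_hoch_cup /cup evB mulrBr.
Qed.

Lemma hoch_cup_cocycle n m (u : C n) (v : C m) :
  u \in Z n -> v \in Z m -> hoch_cup u v \in Z (n + m)%N.
Proof.
move=> /hoch_cocycleP du /hoch_cocycleP dv; apply/hoch_cocycleP => s.
rewrite (eq_hdiff (G := cup n (ev u) (ev v))) => [|? _]; last exact: ev_hoch_cup.
rewrite hdiff_cup; last exact: ev_arity.
by rewrite /cup du dv mul0r mulr0 scaler0 addr0.
Qed.

Lemma hoch_cup_coboundaryl n m (u : C n) (v : C m) :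
  u \in B n -> v \in Z m -> hoch_cup u v \in B (n + m)%N.
Proof.
move=> uB /hoch_cocycleP dv; move: u uB.
apply: hoch_coboundary_ind => [_|p w np u uw]; last subst n.
  by rewrite -(subrr 0) hoch_cupBl subrr mem0v.
apply: (hoch_coboundary (w := hoch_cup w v)); first by [].
move=> s _; rewrite ev_hoch_cup (eq_hdiff (G := cup p (ev w) (ev v))) => [|? _].
  rewrite hdiff_cup; last exact: ev_arity.
  by rewrite /cup dv mulr0 scaler0 addr0 -uw.
exact: ev_hoch_cup.
Qed.

Lemma hoch_cup_coboundaryr n m (u : C n) (v : C m) :
  u \in Z n -> v \in B m -> hoch_cup u v \in B (n + m)%N.
Proof.
move=> /hoch_cocycleP du; move: v; apply: hoch_coboundary_ind => [_|p w mp v vw]; last subst m.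
  by rewrite -(subrr 0) hoch_cupBr subrr mem0v.
(* The sign compensates the one in the Leibniz rule. *)
apply: (hoch_coboundary (w := (-1) ^+ n *: hoch_cup u w)); first by rewrite addnS.
move=> s _; rewrite ev_hoch_cup.
rewrite (eq_hdiff (G := fun s => (-1) ^+ n *: cup n (ev u) (ev w) s)) => [|? _].
  rewrite hdiffZ hdiff_cup; last exact: ev_arity.
  by rewrite /cup du mul0r add0r scalerA -expr2 sqrr_sign scale1r -vw.
by rewrite evZ ev_hoch_cup.
Qed.

Lemma hoch_bracketBl n m (v : C m) :
  {morph (@hoch_bracket k gT n m)^~ v : u u' / u - u'}.
Proof.
move=> u u'; apply: eq_cochain => s _ _; rewrite [RHS]evB !ev_hoch_bracket -lieBl.
by apply: eq_lie => // t; apply: evB.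
Qed.

Lemma hoch_bracketBr n m (u : C n) :
  {morph @hoch_bracket k gT n m u : v v' / v - v'}.
Proof.
move=> v v'; apply: eq_cochain => s _ _; rewrite [RHS]evB !ev_hoch_bracket -lieBr.
by apply: eq_lie => // t; apply: evB.
Qed.

Lemma hoch_bracket_cocycle n m (u : C n) (v : C m) :
  u \in Z n -> v \in Z m -> hoch_bracket u v \in Z (n + m).-1.
Proof.
move=> /hoch_cocycleP du /hoch_cocycleP dv; apply/hoch_cocycleP => s.
rewrite (eq_hdiff (G := lie n m (ev u) (ev v))) => [|? _]; last exact: ev_hoch_bracket.
have [sn|sn] := eqVneq (size s) (n + m)%N.
  rewrite hdiff_lie //; try exact: ev_arity.
  rewrite (eq_lie _ _ _ (fun=> erefl) dv) (eq_lie _ _ _ du (fun=> erefl)).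
  by rewrite lie0l lie0r scaler0 addr0.
rewrite (eq_hdiff (G := fun=> 0)) ?hdiff0 // => t ts.
by rewrite lie_arity ?ts //; apply: ev_arity.
Qed.

Lemma hoch_bracket_coboundaryl n m (u : C n) (v : C m) :
  u \in B n -> v \in Z m -> hoch_bracket u v \in B (n + m).-1.
Proof.
move=> uB /hoch_cocycleP dv; move: u uB.
apply: hoch_coboundary_ind => [_|p w np u uw]; last subst n.
  by rewrite -(subrr 0) hoch_bracketBl subrr mem0v.
apply: (hoch_coboundary (w := (-1) ^+ m.+1 *: hoch_bracket w v)); first by [].
move=> s sn; rewrite ev_hoch_bracket (eq_lie _ _ _ uw (fun=> erefl)).
rewrite (eq_hdiff (G := fun s => (-1) ^+ m.+1 *: lie p m (ev w) (ev v) s)) => [|? _].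
  rewrite hdiffZ hdiff_lie //; try exact: ev_arity.
  by rewrite (eq_lie _ _ _ (fun=> erefl) dv) lie0r add0r scalerA -expr2 sqrr_sign scale1r.
by rewrite evZ ev_hoch_bracket.
Qed.

Lemma hoch_bracket_coboundaryr n m (u : C n) (v : C m) :
  u \in Z n -> v \in B m -> hoch_bracket u v \in B (n + m).-1.
Proof.
move=> /hoch_cocycleP du; move: v; apply: hoch_coboundary_ind => [_|p w mp v vw]; last subst m.
  by rewrite -(subrr 0) hoch_bracketBr subrr mem0v.
apply: (hoch_coboundary (w := hoch_bracket u w)); first by rewrite addnS.
move=> s; rewrite [X in size s = X](congr1 predn (addnS n p)) => sn.
rewrite ev_hoch_bracket (eq_lie _ _ _ (fun=> erefl) vw).
rewrite (eq_hdiff (G := lie n p (ev u) (ev w))) => [|? _]; last exact: ev_hoch_bracket.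
rewrite hdiff_lie //; try exact: ev_arity.
by rewrite (eq_lie _ _ _ du (fun=> erefl)) lie0l scaler0 addr0.
Qed.

Lemma eq_bv_fun (F G : seq gT -> kG) s : F =1 G -> bv_fun F s = bv_fun G s.
Proof.
move=> FG; apply/ffunP => g; rewrite !ffunE; congr (_ *: _).
by apply: eq_cyc_norm => u _; rewrite FG.
Qed.

Lemma bv_funB (F G : seq gT -> kG) s :
  bv_fun (fun u => F u - G u) s = bv_fun F s - bv_fun G s.
Proof.
apply/ffunP => g; rewrite !ffunE -scalerBr; congr (_ *: _).
by rewrite /cyc_norm -sumrB; apply: eq_bigr => i _; rewrite -scalerBr !ffunE.
Qed.

Lemma hoch_bvB n : {morph @hoch_bv k gT n : u u' / u - u'}.
Proof.
move=> u u'; apply: eq_cochain => s _ _; rewrite [RHS]evB !ev_hoch_bv -bv_funB.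
by apply: eq_bv_fun => t; apply: evB.
Qed.

Lemma bv_fun0 s : bv_fun (fun=> 0 : kG) s = 0.
Proof.
rewrite -[RHS](subrr (bv_fun (fun=> 0) s)) -bv_funB.
by apply: eq_bv_fun => u; rewrite subrr.
Qed.

Lemma hoch_bv_cocycle n (u : C n) : u \in Z n -> hoch_bv u \in Z n.-1.
Proof.
move=> /hoch_cocycleP du; apply/hoch_cocycleP => s.
rewrite (eq_hdiff (G := bv_fun (ev u))) => [|? _]; last exact: ev_hoch_bv.
by rewrite hdiff_bv_fun (eq_bv_fun _ du) bv_fun0 oppr0.
Qed.

Lemma hoch_bv_coboundary n (u : C n) : u \in B n -> hoch_bv u \in B n.-1.
Proof.
move: u; 
apply: hoch_coboundary_ind => [_|p w np u uw]; last subst n.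
  by rewrite -(subrr 0) hoch_bvB subrr mem0v.
apply: (hoch_coboundary (w := - hoch_bv w)); first by [].
move=> s _; rewrite ev_hoch_bv (eq_bv_fun _ uw) -[LHS]opprK -hdiff_bv_fun -scaleN1r -hdiffZ.
by apply: eq_hdiff => t _; rewrite -[- hoch_bv w]sub0r evB ev0 sub0r scaleN1r ev_hoch_bv.
Qed.

Lemma HH_cup_induced n m : induces2 (@hoch_cup k gT n m) (@HH_cup k gT n m).
Proof.
apply: induces2_sqlift; [exact: hoch_cupBl | exact: hoch_cupBr | exact: hoch_cup_cocycle
  | exact: hoch_cup_coboundaryl | exact: hoch_cup_coboundaryr].
Qed.

Lemma HH_bracket_induced n m :
  induces2 (@hoch_bracket k gT n m) (@HH_bracket k gT n m).
Proof.
apply: induces2_sqlift; [exact: hoch_bracketBl | exact: hoch_bracketBr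
  | exact: hoch_bracket_cocycle | exact: hoch_bracket_coboundaryl
  | exact: hoch_bracket_coboundaryr].
Qed.

Lemma HH_bv_induced n : induces1 (@hoch_bv k gT n) (@HH_bv k gT n).
Proof.
apply: induces1_sqlift; first exact: hoch_bvB; first exact: hoch_bv_cocycle.
by move=> u _; apply: hoch_bv_coboundary.
Qed.

End HochschildCohomology.

(** * Group cohomology as a retract *)

Section Retraction.
Variables (k : fieldType) (gT : finGroupType).
Local Notation kG := (galg k gT).
Local Notation C := (cochain gT kG).
Local Notation D := (cochain gT k^o).
Local Notation "<< g >>" := (galg_elt k g).
Local Notation prodl s := (\prod_(g <- s) g)%g.
Implicit Types (n m : nat) (s : seq gT) (a : gT).

Lemma prod_rcons s a : prodl (rcons s a) = (prodl s * a)%g.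
Proof. by rewrite -cats1 big_cat big_seq1. Qed.

Lemma prod_merge_at i s : (0 < i < size s)%N -> prodl (merge_at i s) = prodl s.
Proof.
case: i => // i /= si; rewrite /merge_at /= big_cat big_cons /=.
rewrite -[in RHS](cat_take_drop i s) big_cat (drop_nth 1%g (ltnW si)).
by rewrite (drop_nth 1%g si) !big_cons /= !mulgA.
Qed.

Lemma prod_rev_inv s : (\prod_(g <- rev s) g^-1 = (prodl s)^-1)%g.
Proof.
elim: s => [|a s IH]; first by rewrite !big_nil invg1.
by rewrite rev_cons -cats1 big_cat big_seq1 /= IH big_cons invMg.
Qed.

(** A rotation conjugates the product. *)
Lemma prod_rot1 i s : (prodl (rot i s) == 1%g) = (prodl s == 1%g).
Proof.
rewrite /rot -[in RHS](cat_take_drop i s) !big_cat /=.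
by rewrite -!eq_invg_mul eq_invg_sym eq_sym.
Qed.

(** The left inverse of the inclusion; it is defined on all Hochschild cochains, hence also applies
    to primitives. *)
Definition retract n (u : C n) : D n := mkcochain n (fun s => ev u s (prodl s) : k^o).

Lemma ev_retract n (u : C n) s : ev (retract u) s = ev u s (prodl s).
Proof.
apply: (ev_mkcochain (G := fun s => ev u s (prodl s) : k^o)) => // {}s hs.
  by rewrite ev_arity // ffunE.
by rewrite ev_normalized // ffunE.
Qed.

Lemma ev_incl n (f : D n) s : ev (incl_cochain f) s = ev f s *: <<prodl s>>.
Proof.
apply: (ev_mkcochain (G := fun s => ev f s *: <<prodl s>>)) => {}s.
- by move=> sn; rewrite ev_arity // scale0r.
- by move=> s1; rewrite ev_normalized // scale0r.
- by move=> sn _; rewrite evE.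
Qed.

Lemma incl_cochainK n : cancel (@incl_cochain k gT n) (@retract n).
Proof.
move=> f; apply: eq_cochain => s _ _.
by rewrite ev_retract ev_incl ffunE galg_eltE eqxx /GRing.scale /= mulr1.
Qed.

Lemma ev_grp_diff n (f : D n) s : size s = n.+1 -> 1%g \notin s ->
  ev (grp_diff f) s = ev f (behead s) + bar (ev f) s + (-1) ^+ n.+1 *: ev f (take n s).
Proof.
move=> sn s1; have [t st] := tuple_gbar sn s1; rewrite {1}st ev_val ffunE -st drop1.
rewrite -[_ * cev f (take _ _)]/(_ *: _) /bar sn !evE ?size_behead ?sn ?size_takel ?sn //.
congr (_ + _ + _); apply: eq_big_nat => i; rewrite -sn => /size_merge_at; rewrite sn => -[si].
by rewrite evE.
Qed.

(** Merges preserve the product of the list, and an outer multiplication translates the product and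
    the coefficient alike. *)
Lemma retract_hoch_diff n (u : C n) : retract (hoch_diff u) = grp_diff (retract u).
Proof.
apply: eq_cochain => s sn s1; rewrite ev_grp_diff // ev_retract ev_hoch_diff /hdiff.
rewrite !ev_retract !ffunE sn bar_coef; congr (_ + _ + _ *: _).
- by case: s sn {s1} => // a s _; rewrite /= mul_galg_eltl big_cons mulKg.
- rewrite /bar; apply: eq_big_nat => i si; rewrite ev_retract prod_merge_at //.
- case/lastP: s sn {s1} => // s a; rewrite size_rcons => -[sn].
  by rewrite last_mul_rcons mul_galg_eltr prod_rcons mulgK -cats1 take_size_cat.
Qed.

Lemma hoch_diff_incl n (f : D n) : hoch_diff (incl_cochain f) = incl_cochain (grp_diff f).
Proof.
apply: eq_cochain => s sn s1; rewrite ev_hoch_diff ev_incl ev_grp_diff // /hdiff sn.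
rewrite !scalerDl; congr (_ + _ + _).
- by case: s {s1} sn => // a s _; rewrite /= ev_incl big_cons galg_eltM -scalerAr.
- rewrite /bar scaler_suml; apply: eq_big_nat => i si.
  by rewrite ev_incl prod_merge_at // scalerA.
- case/lastP: s sn {s1} => // s a; rewrite size_rcons => -[sn].
  rewrite last_mul_rcons ev_incl -cats1 take_size_cat // cats1 prod_rcons.
  by rewrite galg_eltM -scalerAl scalerA.
Qed.

Lemma incl_cochain_linear n : linear (@incl_cochain k gT n).
Proof.
move=> c f g; apply/ffunP => t; rewrite !ffunE cev_linear.
by rewrite scalerDl scalerA.
Qed.

Lemma retract_linear n : linear (@retract n).
Proof.
move=> c f g; apply/ffunP => t; rewrite !ffunE /ev; case: eqP => _; last first.
  by rewrite !ffunE scaler0 addr0.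
by rewrite cev_linear !ffunE.
Qed.

End Retraction.

(** * The inclusion in cohomology and the restricted operations *)

Section Inclusion.
Variables (k : fieldType) (gT : finGroupType).
Local Notation kG := (galg k gT).
Local Notation C := (cochain gT kG).
Local Notation D := (cochain gT k^o).
Local Notation CV := (fun n => cochain gT (galg k gT) n : vectType k).
Local Notation DV := (fun n => cochain gT k^o n : vectType k).
Local Notation dH := (fun i => @hoch_diff k gT i : {linear _ -> _}).
Local Notation dG := (fun i => @grp_diff k gT i : {linear _ -> _}).
Local Notation ZH n := (cocycles (C := CV) dH n).
Local Notation BH n := (coboundaries (C := CV) dH n).
Local Notation ZG n := (cocycles (C := DV) dG n).
Local Notation BG n := (coboundaries (C := DV) dG n).
Local Notation "<< g >>" := (galg_elt k g).
Local Notation prodl s := (\prod_(g <- s) g)%g.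

HB.instance Definition _ n := GRing.isSemilinear.Build k (D n) (C n) _
  (@incl_cochain k gT n) (GRing.semilinear_linear (@incl_cochain_linear k gT n)).
HB.instance Definition _ n := GRing.isSemilinear.Build k (C n) (D n) _
  (@retract k gT n) (GRing.semilinear_linear (@retract_linear k gT n)).

Lemma incl_cocycle n (f : D n) : f \in ZG n -> incl_cochain f \in ZH n.
Proof.
move=> /cocyclesP df; apply/cocyclesP.
by rewrite [LHS]hoch_diff_incl [grp_diff f]df [LHS]linear0.
Qed.

Lemma retract_cocycle n (u : C n) : u \in ZH n -> retract u \in ZG n.
Proof.
move=> /cocyclesP du; apply/cocyclesP.
by rewrite -[LHS]retract_hoch_diff [hoch_diff u]du [LHS]linear0.
Qed.

Lemma incl_coboundary n (f : D n) : f \in BG n -> incl_cochain f \in BH n.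
Proof.
case: n f => [|n] f; first by move=> /coboundaries0->; rewrite linear0 mem0v.
case/coboundariesSP => w ->; apply/coboundariesSP; exists (incl_cochain w).
by rewrite -[LHS]hoch_diff_incl.
Qed.

Lemma retract_coboundary n (u : C n) : u \in BH n -> retract u \in BG n.
Proof.
case: n u => [|n] u; first by move=> /coboundaries0->; rewrite linear0 mem0v.
case/coboundariesSP => w ->; apply/coboundariesSP; exists (retract w).
by rewrite [LHS]retract_hoch_diff.
Qed.

Lemma incl_induced n : induces1 (@incl_cochain k gT n) (@incl k gT n).
Proof.
apply: induces1_sqlift; [exact: linearB | exact: incl_cocycle |].
by move=> u _; apply: incl_coboundary.
Qed.

Lemma HG_classK n (x : HG k gT n) : HG_class (sqrep x) = x.
Proof. exact: sqrepK. Qed.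

Lemma incl_HG_class n (f : D n) : f \in ZG n -> incl (HG_class f) = HH_class (incl_cochain f).
Proof. by case/incl_induced. Qed.

Lemma HG_classP n (Q : HG k gT n -> Prop) :
  (forall f, f \in ZG n -> Q (HG_class f)) -> forall x, Q x.
Proof. by move=> QZ x; rewrite -(HG_classK x); apply/QZ/sqrep_mem. Qed.

Lemma incl_linear n : linear (@incl k gT n).
Proof.
move=> c; elim/HG_classP => f fZ; elim/HG_classP => g gZ.
have cf : c *: f \in ZG n by rewrite rpredZ.
rewrite -[c *: HG_class f]/(sqscale _ _) -sqclassZ // -sqclassD.
rewrite ![incl _]incl_HG_class ?rpredD // linearP /HH_class sqclassD sqclassZ //.
exact: incl_cocycle.
Qed.

(** The retraction sends a primitive of the included cochain to a primitive of the original one. *)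
Lemma incl_inj n : injective (@incl k gT n).
Proof.
elim/HG_classP => f fZ; elim/HG_classP => g gZ; rewrite !incl_HG_class // => /eqP.
rewrite sqclass_eq ?incl_cocycle // -linearB => /retract_coboundary.
by rewrite incl_cochainK => fgB; apply/eqP; rewrite sqclass_eq.
Qed.

Lemma hoch_cup_incl n m (f : D n) (g : D m) :
  hoch_cup (incl_cochain f) (incl_cochain g) = incl_cochain (grp_cup f g).
Proof.
apply: eq_cochain => s sn s1; rewrite ev_hoch_cup /cup !ev_incl.
rewrite -scalerAl -scalerAr scalerA -galg_eltM -big_cat cat_take_drop.
congr (_ *: _); have [t st] := tuple_gbar sn s1; rewrite {3}st ev_val ffunE -st.
have sd : size (drop n s) = m by rewrite size_drop sn addKn.
have st' : size (take n s) = n by rewrite size_takel // sn leq_addr.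
by rewrite !evE.
Qed.

(** The coefficient at 1 survives only if the letters multiply to 1, a condition stable under
    rotation. It forces the added letter to be the inverse of the product of [s], as in [grp_bv]. *)
Lemma hoch_bv_incl n (f : D n) : hoch_bv (incl_cochain f) = incl_cochain (grp_bv f).
Proof.
case: n f => [|p] f; first by rewrite linear0.
apply: eq_cochain => s sn s1; rewrite ev_hoch_bv ev_incl.
have [t st] := tuple_gbar sn s1; rewrite [in RHS]st ev_val ffunE -st.
apply/ffunP => g; rewrite !ffunE prod_rev_inv.
have coef u : ev (incl_cochain f) u 1%g = ev f u * (prodl u == 1%g)%:R.
  by rewrite ev_incl ffunE galg_eltE eq_sym.
have prod1 i : (prodl (rot i (rcons s g^-1)%g) == 1%g) = (g == prodl s).
  by rewrite prod_rot1 prod_rcons -eq_mulgV1 eq_sym.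
rewrite big_add1 big_mkord /cyc_norm size_rcons sn scaler_sumr scaler_suml.
apply: eq_bigr => i _; rewrite coef prod1; case: eqP => [->|_]; last by rewrite mulr0 !scaler0.
rewrite /GRing.scale /= !mulr1 mulSn exprD mulrA evE //.
by rewrite size_rot size_rcons sn.
Qed.

(** Replacing a block of letters by its product does not change the total product. *)
Lemma circ_incl n m (f : D n) (g : D m) s :
  circ m (ev (incl_cochain f)) (ev (incl_cochain g)) s \in <[galg_elt k (prodl s)]>%VS.
Proof.
apply: rpred_sum => j _; apply: rpredZ; rewrite /insert_at ev_incl linearZ rpredZ //=.
rewrite lext_basis ev_incl rpredZ //.
rewrite big_cat big_cons addnC -drop_drop /= -big_cat cat_take_drop -big_cat.
by rewrite cat_take_drop memv_line.
Qed.

(** The bracket of included cochains is already an included cochain, so closure needs no formula for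
    a bracket on group cochains. *)
Lemma incl_retract_bracket n m (f : D n) (g : D m) :
  let b := hoch_bracket (incl_cochain f) (incl_cochain g) in
  incl_cochain (retract b) = b.
Proof.
apply: eq_cochain => s _ _; rewrite ev_incl ev_retract ev_hoch_bracket.
have /vlineP[c ->] :
    lie n m (ev (incl_cochain f)) (ev (incl_cochain g)) s \in <[galg_elt k (prodl s)]>%VS.
  by rewrite rpredB ?rpredZ ?circ_incl.
by rewrite ffunE galg_eltE eqxx [c *: 1]mulr1.
Qed.

(** Passing through the retraction lets the group operations inherit bilinearity and compatibility
    with coboundaries from the Hochschild ones. *)
Lemma grp_cupE n m (f : D n) (g : D m) :
  grp_cup f g = retract (hoch_cup (incl_cochain f) (incl_cochain g)).
Proof. by rewrite hoch_cup_incl incl_cochainK. Qed.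

Lemma grp_bvE n (f : D n) : grp_bv f = retract (hoch_bv (incl_cochain f)).
Proof. by rewrite hoch_bv_incl incl_cochainK. Qed.

Lemma HG_cup_induced n m : induces2 (@grp_cup k gT n m) (@HG_cup k gT n m).
Proof.
apply: induces2_sqlift => [g f f'|f g g'|f g fZ gZ|f g fB gZ|f g fZ gB]; rewrite !grp_cupE.
- by rewrite linearB hoch_cupBl linearB.
- by rewrite linearB hoch_cupBr linearB.
- exact/retract_cocycle/hoch_cup_cocycle/incl_cocycle/gZ/incl_cocycle.
- by apply/retract_coboundary/hoch_cup_coboundaryl/incl_cocycle/gZ/incl_coboundary.
- by apply/retract_coboundary/hoch_cup_coboundaryr/incl_coboundary/gB/incl_cocycle.
Qed.

Lemma HG_bv_induced n : induces1 (@grp_bv k gT n) (@HG_bv k gT n).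
Proof.
apply: induces1_sqlift => [f f'|f fZ|f _ fB]; rewrite !grp_bvE.
- by rewrite linearB hoch_bvB linearB.
- exact/retract_cocycle/hoch_bv_cocycle/incl_cocycle.
- exact/retract_coboundary/hoch_bv_coboundary/incl_coboundary.
Qed.

Lemma HH_cup_incl n m (x : HG k gT n) (y : HG k gT m) :
  HH_cup (incl x) (incl y) = incl (HG_cup x y).
Proof.
elim/HG_classP: x => f fZ; elim/HG_classP: y => g gZ.
have [cZ ->] := HG_cup_induced fZ gZ; rewrite !incl_HG_class //.
by have [_ ->] := HH_cup_induced (incl_cocycle fZ) (incl_cocycle gZ); rewrite hoch_cup_incl.
Qed.

Lemma HH_bv_incl n (x : HG k gT n) : HH_bv (incl x) = incl (HG_bv x).
Proof.
elim/HG_classP: x => f fZ; have [bZ ->] := HG_bv_induced fZ; rewrite !incl_HG_class //.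
by have [_ ->] := HH_bv_induced (incl_cocycle fZ); rewrite hoch_bv_incl.
Qed.

Lemma HH_bracket_incl n m (x : HG k gT n) (y : HG k gT m) :
  in_HG (HH_bracket (incl x) (incl y)).
Proof.
elim/HG_classP: x => f fZ; elim/HG_classP: y => g gZ; rewrite !incl_HG_class //.
have [bZ ->] := HH_bracket_induced (incl_cocycle fZ) (incl_cocycle gZ).
exists (HG_class (retract (hoch_bracket (incl_cochain f) (incl_cochain g)))).
by rewrite incl_HG_class ?retract_cocycle // incl_retract_bracket.
Qed.

Lemma incl_unit : incl (HG_class (grp_unit k gT)) = HH_class (hoch_unit k gT).
Proof.
rewrite incl_HG_class.
  congr HH_class; apply/ffunP => t; rewrite !ffunE -evE ?size_map ?size_tuple // ev_val.
  by rewrite ffunE scale1r tuple0 big_nil.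
(* In degree 0 the two outer terms of the differential are equal with opposite signs. *)
apply/cocyclesP/eq_cochain => s s_1 s1; rewrite [LHS]ev_grp_diff // ev0.
by case: s s_1 {s1} => [|a []] //= _; rewrite bar_1 addr0 scaleN1r subrr.
Qed.

End Inclusion.


Theorem corollary8p4 (k : fieldType) (gT : finGroupType) :
  [/\ (* the operations on HH^*(kG) and H^*(G,k) are well defined *)
      [/\ forall n m, induces2 (@hoch_cup k gT n m) (@HH_cup k gT n m),
          forall n m, induces2 (@hoch_bracket k gT n m) (@HH_bracket k gT n m),
          forall n, induces1 (@hoch_bv k gT n) (@HH_bv k gT n),
          forall n m, induces2 (@grp_cup k gT n m) (@HG_cup k gT n m)
        & forall n, induces1 (@grp_bv k gT n) (@HG_bv k gT n)],
      (* the inclusion is induced by a cochain map, linear and injective *)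
      [/\ forall n (f : cochain gT k^o n),
            hoch_diff (incl_cochain f) = incl_cochain (grp_diff f),
          forall n, induces1 (@incl_cochain k gT n) (@incl k gT n),
          forall n, linear (@incl k gT n)
        & forall n, injective (@incl k gT n)],
      (* the image is closed under the operations (and contains the unit) *)
      [/\ in_HG (HH_class (hoch_unit k gT)),
          forall n m (u : HH k gT n) (v : HH k gT m),
            in_HG u -> in_HG v -> in_HG (HH_cup u v),
          forall n m (u : HH k gT n) (v : HH k gT m),
            in_HG u -> in_HG v -> in_HG (HH_bracket u v)
        & forall n (u : HH k gT n), in_HG u -> in_HG (HH_bv u)]
    & (* the operations of HH^*(kG) restrict to those of H^*(G,k) *)
      [/\ incl (HG_class (grp_unit k gT)) = HH_class (hoch_unit k gT),
          forall n m (x : HG k gT n) (y : HG k gT m),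
            HH_cup (incl x) (incl y) = incl (HG_cup x y)
        & forall n (x : HG k gT n), HH_bv (incl x) = incl (HG_bv x)]].
Proof.
split; split.
- exact: HH_cup_induced.
- exact: HH_bracket_induced.
- exact: HH_bv_induced.
- exact: HG_cup_induced.
- exact: HG_bv_induced.
- exact: hoch_diff_incl.
- exact: incl_induced.
- exact: incl_linear.
- exact: incl_inj.
- by exists (HG_class (grp_unit k gT)); rewrite incl_unit.
- by move=> n m _ _ [x ->] [y ->]; rewrite HH_cup_incl; exists (HG_cup x y).
- by move=> n m _ _ [x ->] [y ->]; apply: HH_bracket_incl.
- by move=> n _ [x ->]; rewrite HH_bv_incl; exists (HG_bv x).
- exact: incl_unit.
- exact: HH_cup_incl.
- exact: HH_bv_incl.
Qed.
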